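(* Let $\omega$ be a random variable uniformly distributed on the unit circle $\{|z|=1\}\subset\mathbb{C}$. Then for every integer $n\geq 0$, $$\lim_{k\to\infty}\mathbb{E}\,\Big|\frac{P_k(\omega)}{\sqrt{2^{k+1}}}\Big|^{2n}=\frac{1}{n+1},$$ and for all $0\le\alpha<\beta\le1$, $$\lim_{k\to\infty}\mathbb{P}\Big(\Big|\frac{P_k(\omega)}{\sqrt{2^{k+1}}}\Big|^2\in[\alpha,\beta]\Big)=\beta-\alpha.$$
   Context: The Rudin–Shapiro polynomials are defined by $P_0(z)=Q_0(z)=1$ and, for $k\ge0$, $P_{k+1}(z)=P_k(z)+z^{2^k}Q_k(z)$, $Q_{k+1}(z)=P_k(z)-z^{2^k}Q_k(z)$. They have degree $2^k-1$ and all coefficients in $\{1,-1\}$. *)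

(* Defs.v *)
From Stdlib Require Import Reals List.
Import ListNotations.
Open Scope R_scope.

(* Polynomials with real coefficients as coefficient lists, lowest degree first. *)
Fixpoint padd (p q : list R) : list R :=
  match p, q with
  | nil, _ => q
  | _, nil => p
  | a :: p', b :: q' => (a + b) :: padd p' q'
  end.

Definition pshift (m : nat) (p : list R) : list R := repeat 0 m ++ p.

Definition popp (p : list R) : list R := map Ropp p.

(* Rudin–Shapiro pair (P_k, Q_k):
   P_0 = Q_0 = 1,  P_{k+1} = P_k + z^{2^k} Q_k,  Q_{k+1} = P_k - z^{2^k} Q_k. *)
Fixpoint RS (k : nat) : list R * list R :=
  match k with
  | O => ([1], [1])
  | S k' => let (p, q) := RS k' in
            (padd p (pshift (2 ^ k') q), padd p (popp (pshift (2 ^ k') q)))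
  end.

Definition RSP (k : nat) : list R := fst (RS k).

(* Real and imaginary parts of p(e^{i t}) = sum_j c_j e^{i j t}. *)
Fixpoint ev_re_from (p : list R) (j : nat) (t : R) : R :=
  match p with
  | nil => 0
  | c :: p' => c * cos (INR j * t) + ev_re_from p' (S j) t
  end.
Fixpoint ev_im_from (p : list R) (j : nat) (t : R) : R :=
  match p with
  | nil => 0
  | c :: p' => c * sin (INR j * t) + ev_im_from p' (S j) t
  end.

Definition modsq_unit (p : list R) (t : R) : R :=
  (ev_re_from p 0 t) ^ 2 + (ev_im_from p 0 t) ^ 2.

Definition rs_normsq (k : nat) (t : R) : R :=
  modsq_unit (RSP k) t / 2 ^ (S k).

Definition ind_cc (a b x : R) : R :=
  if Rle_dec a x then (if Rle_dec x b then 1 else 0) else 0.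

(* Main.v *)
Require Import Defs.
From Stdlib Require Import Reals Lra Lia ZArith List Classical.
From Coquelicot Require Import Coquelicot.
Import ListNotations.
Open Scope R_scope.

(** The recursion for (P_k, Q_k) / sqrt (2^(k+1)) is a walk on unit vectors of C^2:
multiply the second coordinate by z^(2^k), then apply the Hadamard matrix. Fix n and
let F_k,l be the l-th Fourier coefficient, in the variable z^(2^k), of the n-th tensor
power of the density matrix of this vector. The coefficients satisfy the finite linear recursion
F_(k+1),l[w] = walsh (b |-> F_k,(2l - wt b)[b]), and it does not increase the l^2 norm.
The norm lost at step k is carried by the entries with l + wt w odd, so these
tend to 0. The Walsh transform turns this parity into (anti)symmetry under
complementing all bits, which reverses the weight; so if F_k,l -> 0 whenever |l| > D,
with D >= 1, then also F_k,l -> 0 whenever |l| >= D. Hence only l = 0 survives, and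
F_k,0 and its Walsh transform are both asymptotically supported on weight 0.
Conjugating the weight operator by the Walsh transform then gives
j m_(j-1) - (n - j + 1) m_j -> 0 for m_j = E |u|^(2(n-j)) |v|^(2j). So the n + 1
numbers C(n,j) m_j are asymptotically equal; they add up to 1, and all converge
to 1/(n+1). These are the Bernstein moments of |u|^2, so Bernstein's approximation
of indicator functions gives the uniform limit law. *)

(** * The Walsh transform on words *)

(** A letter is the row bit and column bit of a 2 by 2 matrix entry, so a word of length n indexes
    an entry of an n-fold tensor power of such matrices. *)
Definition letter := (bool * bool)%type.
Definition word := list letter.

Definition lsum (g : letter -> R) : R :=
  g (false, false) + g (false, true) + g (true, false) + g (true, true).

Fixpoint wsum (n : nat) (f : word -> R) : R :=
  match n with
  | O => f nil
  | S n' => lsum (fun c => wsum n' (fun w => f (c :: w)))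
  end.

Definition had (b b' : bool) : R := if andb b b' then -1 else 1.

(** Matrix of [X |-> H X H / 2], where H is the 2 by 2 Hadamard matrix. It is symmetric and
    orthogonal, so [walsh] is an involution and an isometry. *)
Definition hmat (c c' : letter) : R :=
  had (fst c) (fst c') * had (snd c) (snd c') / 2.

Fixpoint walsh (w : word) (f : word -> R) : R :=
  match w with
  | nil => f nil
  | c :: w' => lsum (fun c' => hmat c c' * walsh w' (fun v => f (c' :: v)))
  end.

Definition cntA (w : word) : Z :=
  fold_right (fun c s => (Z.b2z (fst c) + s)%Z) 0%Z w.
Definition cntB (w : word) : Z :=
  fold_right (fun c s => (Z.b2z (snd c) + s)%Z) 0%Z w.
(** The power of z that an entry acquires when the second coordinate of the vector is multiplied by
    z: row bits contribute z, column bits its conjugate. *)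
Definition wt (w : word) : Z := (cntA w - cntB w)%Z.

Definition lflip (c : letter) : letter := (negb (fst c), negb (snd c)).
Definition flip (w : word) : word := map lflip w.

Lemma lsum_ext (g h : letter -> R) : (forall c, g c = h c) -> lsum g = lsum h.
Proof. intros H; unfold lsum; now rewrite !H. Qed.

Lemma wsum_ext (n : nat) (f g : word -> R) :
  (forall w, length w = n -> f w = g w) -> wsum n f = wsum n g.
Proof.
revert f g; induction n as [|n IH]; intros f g H; simpl.
- now apply H.
- apply lsum_ext; intros c; apply IH; intros w Hw; apply H; simpl; lia.
Qed.

Lemma wsum_plus (n : nat) (f g : word -> R) :
  wsum n (fun w => f w + g w) = wsum n f + wsum n g.
Proof.
revert f g; induction n as [|n IH]; intros f g; simpl; [easy|].
unfold lsum; rewrite !IH; ring.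
Qed.

Lemma wsum_zero (n : nat) : wsum n (fun _ => 0) = 0.
Proof. induction n as [|n IH]; simpl; [easy|]. unfold lsum; rewrite IH; ring. Qed.

Lemma wsum_ge0 (n : nat) (f : word -> R) :
  (forall w, length w = n -> 0 <= f w) -> 0 <= wsum n f.
Proof.
revert f; induction n as [|n IH]; intros f H; simpl; [now apply H|].
assert (HH : forall c, 0 <= wsum n (fun w => f (c :: w))).
{ intros c; apply IH; intros w Hw; apply H; simpl; lia. }
unfold lsum; pose proof (HH (false, false)); pose proof (HH (false, true));
pose proof (HH (true, false)); pose proof (HH (true, true)); lra.
Qed.

Lemma wsum_ge_term (n : nat) (f : word -> R) (w0 : word) :
  (forall w, length w = n -> 0 <= f w) -> length w0 = n -> f w0 <= wsum n f.
Proof.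
revert f w0; induction n as [|n IH]; intros f w0 H Hw0; simpl.
- destruct w0; [lra|discriminate].
- destruct w0 as [|c w0]; [discriminate|].
  assert (HH : forall c, 0 <= wsum n (fun w => f (c :: w))).
  { intros c'; apply wsum_ge0; intros w Hw; apply H; simpl; lia. }
  assert (H1 : f (c :: w0) <= wsum n (fun w => f (c :: w))).
  { apply (IH (fun w => f (c :: w)) w0); [|simpl in Hw0; lia].
    intros w Hw; apply H; simpl; lia. }
  unfold lsum; pose proof (HH (false, false)); pose proof (HH (false, true));
  pose proof (HH (true, false)); pose proof (HH (true, true)).
  destruct c as [[] []]; lra.
Qed.

Lemma walsh_ext (w : word) (f g : word -> R) :
  (forall v, length v = length w -> f v = g v) -> walsh w f = walsh w g.
Proof.
revert f g; induction w as [|c w IH]; intros f g H; simpl.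
- now apply H.
- apply lsum_ext; intros c'; f_equal; apply IH; intros v Hv; apply H; simpl; lia.
Qed.

Lemma walsh_plus (w : word) (f g : word -> R) :
  walsh w (fun v => f v + g v) = walsh w f + walsh w g.
Proof.
revert f g; induction w as [|c w IH]; intros f g; simpl; [easy|].
unfold lsum; rewrite !IH; ring.
Qed.

Lemma walsh_scal (w : word) (a : R) (f : word -> R) :
  walsh w (fun v => a * f v) = a * walsh w f.
Proof.
revert f; induction w as [|c w IH]; intros f; simpl; [easy|].
unfold lsum; rewrite !IH; ring.
Qed.

Lemma walsh_lsum (w : word) (h : letter -> R) (f : letter -> word -> R) :
  walsh w (fun v => lsum (fun c => h c * f c v)) =
  lsum (fun c => h c * walsh w (f c)).
Proof. unfold lsum; now rewrite !walsh_plus, !walsh_scal. Qed.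

Lemma walsh_invol (w : word) (f : word -> R) : walsh w (fun v => walsh v f) = f w.
Proof.
revert f; induction w as [|c w IH]; intros f; simpl; [easy|].
rewrite (lsum_ext _ (fun c' => hmat c c' *
  lsum (fun c'' => hmat c' c'' * f (c'' :: w)))).
- destruct c as [[] []]; unfold lsum, hmat, had; simpl; field.
- intros c'; f_equal; rewrite walsh_lsum; apply lsum_ext; intros c''.
  f_equal; apply (IH (fun v => f (c'' :: v))).
Qed.

Lemma walsh_parseval (n : nat) (f : word -> R) :
  wsum n (fun w => (walsh w f) ^ 2) = wsum n (fun w => (f w) ^ 2).
Proof.
revert f; induction n as [|n IH]; intros f; cbn [wsum walsh]; [easy|].
transitivity (lsum (fun c => wsum n (fun w => (walsh w (fun v => f (c :: v))) ^ 2))).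
- unfold lsum; rewrite <- !wsum_plus; apply wsum_ext; intros w _.
  unfold hmat, had; simpl; field.
- apply lsum_ext; intros c; apply (IH (fun v => f (c :: v))).
Qed.

Definition wsign (w : word) : R := if Z.even (wt w) then 1 else -1.

Lemma wt_cons (c : letter) (w : word) :
  wt (c :: w) = (Z.b2z (fst c) - Z.b2z (snd c) + wt w)%Z.
Proof. unfold wt; simpl; lia. Qed.

Lemma wt_flip (w : word) : wt (flip w) = (- wt w)%Z.
Proof.
induction w as [|[a b] w IH]; [easy|].
change (flip ((a, b) :: w)) with ((negb a, negb b) :: flip w).
rewrite !wt_cons, IH; destruct a, b; cbn [Z.b2z fst snd negb]; lia.
Qed.

Lemma length_flip (w : word) : length (flip w) = length w.
Proof. apply length_map. Qed.

Lemma wt_bound (w : word) : (Z.abs (wt w) <= Z.of_nat (length w))%Z.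
Proof.
induction w as [|[a b] w IH]; [easy|].
rewrite wt_cons; cbn [length]; destruct a, b; cbn [Z.b2z fst snd]; lia.
Qed.

Lemma wsign_cons (c : letter) (w : word) :
  wsign (c :: w) = had (fst c) true * had (snd c) true * wsign w.
Proof.
unfold wsign; rewrite wt_cons, Z.even_add.
destruct c as [[] []], (Z.even (wt w)); unfold had; simpl; ring.
Qed.

(** Modulo 2 the weight counts all set bits, so [wsign] is the character paired with the all-ones
    word, and multiplying by a character translates the transform. *)
Lemma walsh_flip (w : word) (f : word -> R) :
  walsh w (fun v => wsign v * f v) = walsh (flip w) f.
Proof.
revert f; induction w as [|c w IH]; intros f.
- simpl; unfold wsign; simpl; ring.
- change (flip (c :: w)) with (lflip c :: flip w); cbn [walsh].
  apply lsum_ext; intros c'.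
  rewrite <- (IH (fun v => f (c' :: v))).
  rewrite (walsh_ext w (fun v => wsign (c' :: v) * f (c' :: v))
    (fun v => (had (fst c') true * had (snd c') true) * (wsign v * f (c' :: v)))).
  + rewrite walsh_scal.
    destruct c as [[] []], c' as [[] []]; unfold hmat, had; simpl; field.
  + intros v _; rewrite wsign_cons; ring.
Qed.

Definition flipA (c : letter) : letter := (negb (fst c), snd c).
Definition flipB (c : letter) : letter := (fst c, negb (snd c)).

(* Conjugate of the diagonal operator [wt] by [walsh]: a signed sum of all
   single-bit flips. *)
Fixpoint wtconj (f : word -> R) (w : word) : R :=
  match w with
  | nil => 0
  | c :: w' => - (f (flipA c :: w') - f (flipB c :: w')) / 2
               + wtconj (fun v => f (c :: v)) w'
  end.

(** A bit a equals [(1 - had a true) / 2], and multiplication by [had a true] after the transform is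
    a flip of that bit before it. The constants 1/2 of the row and column bits cancel. *)
Lemma walsh_wtconj (w : word) (f : word -> R) :
  walsh w (wtconj f) = IZR (wt w) * walsh w f.
Proof.
revert f; induction w as [|c w IH]; intros f; [simpl; unfold wt; simpl; ring|].
cbn [walsh].
rewrite (lsum_ext _ (fun c' => hmat c c' *
  (- / 2 * walsh w (fun v => f (flipA c' :: v)) +
   / 2 * walsh w (fun v => f (flipB c' :: v)) +
   IZR (wt w) * walsh w (fun v => f (c' :: v))))).
- rewrite wt_cons, plus_IZR, minus_IZR.
  destruct c as [[] []]; unfold lsum, hmat, had, flipA, flipB; simpl; field.
- intros c'; f_equal.
  rewrite <- (IH (fun v => f (c' :: v))), <- !walsh_scal, <- !walsh_plus.
  apply walsh_ext; intros v _; cbn [wtconj]; field.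
Qed.

(** Of the n row flips, A lower the row count and n - A raise it; likewise for the columns. *)
Lemma wtconj_counts (mu : Z -> Z -> R) (w : word) :
  let A := cntA w in let B := cntB w in let n := Z.of_nat (length w) in
  wtconj (fun v => mu (cntA v) (cntB v)) w =
  - (IZR A * mu (A - 1)%Z B + IZR (n - A) * mu (A + 1)%Z B
     - IZR B * mu A (B - 1)%Z - IZR (n - B) * mu A (B + 1)%Z) / 2.
Proof.
cbv zeta; revert mu; induction w as [|[a b] w IH]; intros mu.
- simpl; field.
- cbn [wtconj]; cbv beta.
  change (wtconj (fun v => mu (cntA ((a, b) :: v)) (cntB ((a, b) :: v))) w)
    with (wtconj (fun v => mu (Z.b2z a + cntA v)%Z (Z.b2z b + cntB v)%Z) w).
  rewrite (IH (fun x y => mu (Z.b2z a + x)%Z (Z.b2z b + y)%Z)).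
  cbn [length flipA flipB cntA cntB fold_right fst snd].
  fold (cntA w); fold (cntB w).
  rewrite Nat2Z.inj_succ; unfold Z.succ.
  generalize (cntA w) (cntB w) (Z.of_nat (length w)); intros A B n.
  rewrite !minus_IZR, !plus_IZR.
  destruct a, b; cbn [negb Z.b2z];
  replace (1 + (A - 1))%Z with A by lia; replace (1 + (B - 1))%Z with B by lia;
  replace (1 + (A + 1))%Z with (A + 2)%Z by lia;
  replace (1 + (B + 1))%Z with (B + 2)%Z by lia;
  replace (1 + A - 1)%Z with A by lia; replace (1 + B - 1)%Z with B by lia;
  replace (1 + A + 1)%Z with (A + 2)%Z by lia;
  replace (1 + B + 1)%Z with (B + 2)%Z by lia;
  replace (1 + A)%Z with (A + 1)%Z by lia; replace (1 + B)%Z with (B + 1)%Z by lia;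
  rewrite ?Z.add_0_l; field.
Qed.

Lemma walsh_lim0 (w : word) (f : nat -> word -> R) :
  (forall v, length v = length w -> is_lim_seq (fun k => f k v) 0) ->
  is_lim_seq (fun k => walsh w (f k)) 0.
Proof.
revert f; induction w as [|c w IH]; intros f H; cbn [walsh]; [now apply H|].
assert (HH : forall c', is_lim_seq
    (fun k => hmat c c' * walsh w (fun v => f k (c' :: v))) 0).
{ intros c'; replace (Finite 0) with (Rbar_mult (hmat c c') 0)
    by (simpl; f_equal; ring).
  apply is_lim_seq_scal_l.
  apply (IH (fun k v => f k (c' :: v))); intros v Hv; apply H; simpl; lia. }
unfold lsum; replace 0 with (0 + 0 + 0 + 0) by ring.
repeat apply is_lim_seq_plus'; apply HH.
Qed.

(** * Decay of the Fourier coefficients *)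

Fixpoint zsum (a : Z) (L : nat) (g : Z -> R) : R :=
  match L with
  | O => 0
  | S L' => g a + zsum (a + 1) L' g
  end.

Lemma zsum_app (L1 L2 : nat) (a : Z) (g : Z -> R) :
  zsum a (L1 + L2) g = zsum a L1 g + zsum (a + Z.of_nat L1) L2 g.
Proof.
revert a; induction L1 as [|L1 IH]; intros a.
- simpl; rewrite Z.add_0_r; ring.
- cbn [Nat.add zsum]; rewrite IH.
  replace (a + 1 + Z.of_nat L1)%Z with (a + Z.of_nat (S L1))%Z by lia; ring.
Qed.

Lemma zsum_eq0 (L : nat) (a : Z) (g : Z -> R) :
  (forall p, (a <= p < a + Z.of_nat L)%Z -> g p = 0) -> zsum a L g = 0.
Proof.
revert a; induction L as [|L IH]; intros a H; cbn [zsum]; [easy|].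
rewrite H, IH; [ring| |lia]; intros p Hp; apply H; lia.
Qed.

Lemma zsum_window (n L : nat) (a : Z) (g : Z -> R) :
  (forall p, (Z.of_nat n < Z.abs p)%Z -> g p = 0) ->
  (a <= - Z.of_nat n)%Z -> (Z.of_nat n < a + Z.of_nat L)%Z ->
  zsum a L g = zsum (- Z.of_nat n) (2 * n + 1) g.
Proof.
intros H Ha HL.
replace L with (Z.to_nat (- Z.of_nat n - a) +
  ((2 * n + 1) + (L - (2 * n + 1) - Z.to_nat (- Z.of_nat n - a))))%nat by lia.
rewrite !zsum_app, (zsum_eq0 (Z.to_nat _)), (zsum_eq0 (L - _ - _)).
- replace (a + Z.of_nat (Z.to_nat (- Z.of_nat n - a)))%Z
    with (- Z.of_nat n)%Z by lia; ring.
- intros p Hp; apply H; lia.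
- intros p Hp; apply H; lia.
Qed.

(** Separates the indices hit by [l |-> 2 * l - m] from those it misses. *)
Lemma zsum_pairs (L : nat) (a m : Z) (g : Z -> R) :
  zsum a L (fun l => g (2 * l - m)%Z + g (2 * l - m + 1)%Z) =
  zsum (2 * a - m) (2 * L) g.
Proof.
revert a; induction L as [|L IH]; intros a; [easy|].
replace (2 * S L)%nat with (S (S (2 * L))) by lia; cbn [zsum]; rewrite IH.
replace (2 * a - m + 1 + 1)%Z with (2 * (a + 1) - m)%Z by lia; ring.
Qed.

Lemma zsum_plus (L : nat) (a : Z) (g h : Z -> R) :
  zsum a L (fun l => g l + h l) = zsum a L g + zsum a L h.
Proof.
revert a; induction L as [|L IH]; intros a; cbn [zsum]; [ring|].
rewrite IH; ring.
Qed.

Lemma zsum_ge0 (L : nat) (a : Z) (g : Z -> R) :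
  (forall p, 0 <= g p) -> 0 <= zsum a L g.
Proof.
intros H; revert a; induction L as [|L IH]; intros a; cbn [zsum]; [lra|].
pose proof (H a); pose proof (IH (a + 1)%Z); lra.
Qed.

Lemma zsum_ge_term (L : nat) (a p : Z) (g : Z -> R) :
  (forall p, 0 <= g p) -> (a <= p < a + Z.of_nat L)%Z -> g p <= zsum a L g.
Proof.
intros H; revert a; induction L as [|L IH]; intros a Hp; [lia|]; cbn [zsum].
pose proof (zsum_ge0 L (a + 1) g H); pose proof (H a).
destruct (Z.eq_dec a p) as [->|Hne]; [lra|].
assert (g p <= zsum (a + 1) L g) by (apply IH; lia); lra.
Qed.

Lemma zsum_wsum (L n : nat) (a : Z) (h : Z -> word -> R) :
  zsum a L (fun l => wsum n (h l)) = wsum n (fun w => zsum a L (fun l => h l w)).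
Proof.
revert a; induction L as [|L IH]; intros a; cbn [zsum].
- symmetry; apply wsum_zero.
- now rewrite IH, <- wsum_plus.
Qed.

Lemma zsum_ext (L : nat) (a : Z) (g h : Z -> R) :
  (forall p, g p = h p) -> zsum a L g = zsum a L h.
Proof.
intros H; revert a; induction L as [|L IH]; intros a; cbn [zsum]; [easy|].
now rewrite H, IH.
Qed.

Lemma is_lim_seq_diff_decr (N : nat -> R) :
  (forall k, 0 <= N k) -> (forall k, N (S k) <= N k) ->
  is_lim_seq (fun k => N k - N (S k)) 0.
Proof.
intros H0 H1.
destruct (ex_finite_lim_seq_decr N 0 H1 H0) as [l Hl].
replace 0 with (l - l) by ring.
apply is_lim_seq_minus'; [easy|].
now apply (is_lim_seq_incr_1 N).
Qed.

Lemma is_lim_seq_0_scal (a : R) (u : nat -> R) :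
  is_lim_seq u 0 -> is_lim_seq (fun k => a * u k) 0.
Proof.
intros H; replace (Finite 0) with (Rbar_mult a 0) by (simpl; f_equal; ring).
now apply is_lim_seq_scal_l.
Qed.

Lemma is_lim_seq_0_plus (u v : nat -> R) :
  is_lim_seq u 0 -> is_lim_seq v 0 -> is_lim_seq (fun k => u k + v k) 0.
Proof.
intros H1 H2; replace 0 with (0 + 0) by ring; now apply is_lim_seq_plus'.
Qed.

Lemma is_lim_seq_0_sq (u : nat -> R) :
  is_lim_seq (fun k => (u k) ^ 2) 0 -> is_lim_seq u 0.
Proof.
intros H; apply is_lim_seq_spec; apply is_lim_seq_spec in H.
intros eps; simpl in H |- *.
destruct (H (mkposreal (eps * eps) (Rmult_lt_0_compat _ _ (cond_pos eps) (cond_pos eps))))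
  as [K HK]; exists K; intros k Hk.
specialize (HK k Hk); simpl in HK.
pose proof (cond_pos eps) as He.
rewrite Rminus_0_r in HK |- *.
rewrite Rabs_pos_eq in HK by nra.
apply Rabs_def1; nra.
Qed.

(* [F k l w] is to be thought of as the [l]-th Fourier coefficient, with respect
   to the angle [2^k t], of the [w]-component of the tensor at step [k]. *)
Record walk (n : nat) (F : nat -> Z -> word -> R) : Prop := Walk {
  walk_init : forall l w, length w = n -> l <> 0%Z -> F O l w = 0;
  walk_step : forall k l w, length w = n ->
    F (S k) l w = walsh w (fun b => F k (2 * l - wt b)%Z b) }.

(** If |l| > n, then |2l - wt b| >= 2|l| - n > n, so the recursion only reads entries that vanish
    already. *)
Lemma walk_supp n F (HF : walk n F) k l w :
  length w = n -> (Z.of_nat n < Z.abs l)%Z -> F k l w = 0.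
Proof.
revert l w; induction k as [|k IH]; intros l w Hw Hl.
- apply (walk_init n F HF); [easy|lia].
- rewrite (walk_step n F HF) by easy.
  rewrite (walsh_ext w _ (fun _ => 0 * 0)).
  + rewrite (walsh_scal w 0 (fun _ => 0)); ring.
  + intros v Hv; rewrite IH; [ring|lia|].
    pose proof (wt_bound v); lia.
Qed.

Definition energy (n : nat) (G : Z -> word -> R) : R :=
  zsum (- Z.of_nat n) (2 * n + 1) (fun l => wsum n (fun w => (G l w) ^ 2)).

(** By Parseval, step k + 1 collects the squares of step k at the indices [2 * l - wt w] only; the
    intermediate indices are lost. *)
Lemma energy_step n F (HF : walk n F) k :
  energy n (F k) - energy n (F (S k)) =
  wsum n (fun w => zsum (- Z.of_nat n) (2 * n + 1)
    (fun l => (F k (2 * l - wt w + 1)%Z w) ^ 2)).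
Proof.
assert (E1 : energy n (F (S k)) = wsum n (fun w =>
  zsum (- Z.of_nat n) (2 * n + 1) (fun l => (F k (2 * l - wt w)%Z w) ^ 2))).
{ unfold energy.
  rewrite <- (zsum_wsum _ n _ (fun l w => (F k (2 * l - wt w)%Z w) ^ 2)).
  apply zsum_ext; intros l.
  rewrite <- (walsh_parseval n (fun w => F k (2 * l - wt w)%Z w)).
  apply wsum_ext; intros w Hw; now rewrite (walk_step n F HF). }
assert (E0 : energy n (F k) = wsum n (fun w =>
  zsum (- Z.of_nat n) (2 * n + 1) (fun l => (F k (2 * l - wt w)%Z w) ^ 2) +
  zsum (- Z.of_nat n) (2 * n + 1) (fun l => (F k (2 * l - wt w + 1)%Z w) ^ 2))).
{ unfold energy; rewrite zsum_wsum; apply wsum_ext; intros w Hw.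
  rewrite <- zsum_plus, (zsum_pairs _ _ (wt w) (fun p => (F k p w) ^ 2)).
  pose proof (wt_bound w).
  (* The paired indices run from -2n - wt w to 2n + 1 - wt w, which covers [-n, n] because |wt w| <=
     n. *)
  symmetry; apply zsum_window; [|lia|lia].
  intros p Hp; rewrite (walk_supp n F HF) by easy; ring. }
rewrite E0, E1, wsum_plus; ring.
Qed.

Lemma energy_ge0 n G : 0 <= energy n G.
Proof.
apply zsum_ge0; intros l; apply wsum_ge0; intros w _; apply pow2_ge_0.
Qed.

(* The energy lost at each step sits exactly on the entries of odd [l + wt w]. *)
Lemma walk_odd n F (HF : walk n F) l w :
  length w = n -> Z.odd (l + wt w) = true -> is_lim_seq (fun k => F k l w) 0.
Proof.
intros Hw Hodd.
destruct (Z_lt_le_dec (Z.of_nat n) (Z.abs l)) as [Hl|Hl].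
{ apply (is_lim_seq_ext (fun _ => 0)); [|apply is_lim_seq_const].
  intros k; now rewrite (walk_supp n F HF). }
assert (Hge : forall k, (F k l w) ^ 2 <= energy n (F k) - energy n (F (S k))).
{ intros k; rewrite (energy_step n F HF k).
  eapply Rle_trans; [|apply (wsum_ge_term n _ w); [|exact Hw]].
  - apply Z.odd_spec in Hodd; destruct Hodd as [m Hm].
    pose proof (wt_bound w).
    replace l with (2 * m - wt w + 1)%Z by lia.
    apply (zsum_ge_term _ _ m (fun l => (F k (2 * l - wt w + 1)%Z w) ^ 2)).
    + intros p; apply pow2_ge_0.
    + lia.
  - intros v _; apply zsum_ge0; intros p; apply pow2_ge_0. }
(* The energies decrease and are nonnegative, so their successive differences tend to 0 and squeeze
   the square. *)
apply is_lim_seq_0_sq.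
apply (is_lim_seq_le_le (fun _ => 0) _ (fun k => energy n (F k) - energy n (F (S k)))).
- intros k; split; [apply pow2_ge_0|apply Hge].
- apply is_lim_seq_const.
- apply is_lim_seq_diff_decr; intros k; [apply energy_ge0|].
  pose proof (Hge k); pose proof (pow2_ge_0 (F k l w)); lra.
Qed.

(* Undoing [walsh] turns the vanishing of the wrong parity into an (anti)symmetry
   under [flip]. *)
Lemma walk_symm n F (HF : walk n F) l w : length w = n ->
  is_lim_seq (fun k => F k (2 * l - wt w)%Z w
    - (if Z.even l then 1 else -1) * F k (2 * l + wt w)%Z (flip w)) 0.
Proof.
intros Hw; set (s := if Z.even l then 1 else -1).
(* The factor [1 - s * wsign v] vanishes when l + wt v is even, and [walk_odd] handles the odd case.
   Transforming back by [walsh_invol] and [walsh_flip] yields the two terms of the claim. *)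
apply (is_lim_seq_ext (fun k =>
  walsh w (fun v => F (S k) l v + (- s) * (wsign v * F (S k) l v)))).
{ intros k; rewrite walsh_plus, walsh_scal, walsh_flip.
  rewrite (walsh_ext w _ (fun v => walsh v (fun b => F k (2 * l - wt b)%Z b))).
  2:{ intros v Hv; apply (walk_step n F HF); lia. }
  rewrite (walsh_ext (flip w) _ (fun v => walsh v (fun b => F k (2 * l - wt b)%Z b))).
  2:{ intros v Hv; apply (walk_step n F HF); rewrite length_flip in Hv; lia. }
  rewrite !walsh_invol, wt_flip.
  replace (2 * l - - wt w)%Z with (2 * l + wt w)%Z by lia; ring. }
apply walsh_lim0; intros v Hv.
destruct (Z.odd (l + wt v)) eqn:Hodd.
- apply (is_lim_seq_ext (fun k => (1 - s * wsign v) * F (S k) l v));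
    [intros k; ring|].
  apply is_lim_seq_0_scal.
  apply (is_lim_seq_incr_1 (fun k => F k l v)).
  apply (walk_odd n F HF); [lia|easy].
- apply (is_lim_seq_ext (fun _ => 0)); [|apply is_lim_seq_const].
  intros k; unfold s, wsign.
  rewrite <- Z.negb_even, Z.even_add in Hodd.
  destruct (Z.even l), (Z.even (wt v)); simpl in Hodd; try discriminate; ring.
Qed.


(** The indices 2l - wt w and 2l + wt w add up to 4l, and 4|l| > 2D, so at least one of them lies
    beyond D; [walk_symm] carries its decay to the other. *)
Lemma walk_pre n F (HF : walk n F) (D : Z) l :
  (forall v p, length v = n -> (D < Z.abs p)%Z -> is_lim_seq (fun k => F k p v) 0) ->
  (D < 2 * Z.abs l)%Z -> forall w, length w = n ->
  is_lim_seq (fun k => F k (2 * l - wt w)%Z w) 0.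
Proof.
intros HD Hl w Hw.
destruct (Z_lt_le_dec D (Z.abs (2 * l - wt w))) as [H|H]; [now apply HD|].
apply (is_lim_seq_ext (fun k =>
  (F k (2 * l - wt w)%Z w
    - (if Z.even l then 1 else -1) * F k (2 * l + wt w)%Z (flip w)) +
  (if Z.even l then 1 else -1) * F k (2 * l + wt w)%Z (flip w))); [intros k; ring|].
apply is_lim_seq_0_plus; [now apply (walk_symm n F HF)|].
apply is_lim_seq_0_scal; apply HD; [now rewrite length_flip|lia].
Qed.

(** The threshold D = n - d beyond which entries decay is lowered one unit at a time. An index p
    with |p| >= max(D, 1) satisfies 2|p| > D, so by [walk_pre] everything that feeds it decays.
    After n rounds the threshold is 0. *)
Lemma walk_nonzero n F (HF : walk n F) l w :
  length w = n -> l <> 0%Z -> is_lim_seq (fun k => F k l w) 0.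
Proof.
assert (HD : forall d v p, length v = n -> (Z.of_nat (n - d) < Z.abs p)%Z ->
  is_lim_seq (fun k => F k p v) 0).
{ induction d as [|d IH]; intros v p Hv Hp.
  - apply (is_lim_seq_ext (fun _ => 0)); [|apply is_lim_seq_const].
    intros k; rewrite (walk_supp n F HF); [easy|easy|lia].
  - apply (is_lim_seq_incr_1 (fun k => F k p v)).
    apply (is_lim_seq_ext (fun k => walsh v (fun b => F k (2 * p - wt b)%Z b))).
    { intros k; now rewrite (walk_step n F HF). }
    apply walsh_lim0; intros b Hb.
    apply (walk_pre n F HF (Z.of_nat (n - d))); [exact IH|lia|lia]. }
intros Hw Hl; apply (HD n); [easy|lia].
Qed.

(** Odd weights are covered by [walk_odd]. If wt w = 2m with m nonzero, then 0 = 2m - wt w, and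
    [walk_pre] applies with D = 0. *)
Lemma walk_zero n F (HF : walk n F) w :
  length w = n -> wt w <> 0%Z -> is_lim_seq (fun k => F k 0%Z w) 0.
Proof.
intros Hw Hwt.
destruct (Z.odd (wt w)) eqn:Hodd; [now apply (walk_odd n F HF)|].
rewrite <- Z.negb_even in Hodd; apply Bool.negb_false_iff in Hodd.
apply Z.even_spec in Hodd; destruct Hodd as [m Hm].
apply (is_lim_seq_ext (fun k => F k (2 * m - wt w)%Z w)).
{ intros k; f_equal; lia. }
apply (walk_pre n F HF 0%Z); [|lia|easy].
intros v p Hv Hp; apply (walk_nonzero n F HF); [easy|lia].
Qed.

(** The transform of [wtconj (F k 0)] is the weight times the transform of [F k 0], and the latter
    is asymptotically supported on weight 0. *)
Lemma walk_wtconj n F (HF : walk n F) w :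
  length w = n -> is_lim_seq (fun k => wtconj (F k 0%Z) w) 0.
Proof.
intros Hw.
apply (is_lim_seq_ext (fun k => walsh w (fun v => walsh v (wtconj (F k 0%Z))))).
{ intros k; apply walsh_invol. }
apply walsh_lim0; intros v Hv.
apply (is_lim_seq_ext (fun k => IZR (wt v) * walsh v (F k 0%Z))).
{ intros k; now rewrite walsh_wtconj. }
destruct (Z.eq_dec (wt v) 0) as [H0|H0].
{ apply (is_lim_seq_ext (fun _ => 0)); [|apply is_lim_seq_const].
  intros k; rewrite H0; simpl; ring. }
apply is_lim_seq_0_scal.
(* The transform of [F k 0] is compared with [F (S k) 0], which decays at nonzero weight. Their
   inputs differ only at words b with wt b nonzero, where both inputs decay. *)
apply (is_lim_seq_ext (fun k => F (S k) 0%Z v +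
  walsh v (fun b => F k 0%Z b + (-1) * F k (2 * 0 - wt b)%Z b))).
{ intros k; rewrite walsh_plus, walsh_scal, (walk_step n F HF) by lia; ring. }
apply is_lim_seq_0_plus.
{ apply (is_lim_seq_incr_1 (fun k => F k 0%Z v)).
  apply (walk_zero n F HF); [lia|easy]. }
apply walsh_lim0; intros b Hb.
destruct (Z.eq_dec (wt b) 0) as [H1|H1].
{ apply (is_lim_seq_ext (fun _ => 0)); [|apply is_lim_seq_const].
  intros k; rewrite H1; simpl; ring. }
apply is_lim_seq_0_plus; [apply (walk_zero n F HF); [lia|easy]|].
apply is_lim_seq_0_scal; apply (walk_nonzero n F HF); lia.
Qed.

(** * Fourier coefficients of the Rudin-Shapiro walk *)

Definition cis (x : R) : Complex.C := (cos x, sin x).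

Definition ev (p : list R) (j : nat) (t : R) : Complex.C :=
  (ev_re_from p j t, ev_im_from p j t).

(* [P_k(e^{it})] for [false], [Q_k(e^{it})] for [true]. *)
Definition rsval (b : bool) (k : nat) (t : R) : Complex.C :=
  ev (if b then snd (RS k) else fst (RS k)) 0 t.

(* The density matrix of the unit vector [(P_k, Q_k) / sqrt (2 ^ (k + 1))]: the bits of
   a letter index its row and column. *)
Definition dens (k : nat) (t : R) (c : letter) : Complex.C :=
  (RtoC (/ 2 ^ S k) * (rsval (fst c) k t * Cconj (rsval (snd c) k t)))%C.

Fixpoint tens (k : nat) (t : R) (w : word) : Complex.C :=
  match w with
  | nil => RtoC 1
  | c :: w' => (dens k t c * tens k t w')%C
  end.

Lemma C_eq (z w : Complex.C) : fst z = fst w -> snd z = snd w -> z = w.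
Proof. destruct z, w; simpl; congruence. Qed.

Lemma cis_plus x y : cis (x + y) = (cis x * cis y)%C.
Proof. apply C_eq; simpl; [rewrite cos_plus|rewrite sin_plus]; ring. Qed.

Lemma cis_opp x : cis (- x) = Cconj (cis x).
Proof. apply C_eq; simpl; [apply cos_neg|apply sin_neg]. Qed.

Lemma cis_0 : cis 0 = RtoC 1.
Proof. unfold cis; now rewrite cos_0, sin_0. Qed.

Lemma cis_conj x : (cis x * Cconj (cis x))%C = RtoC 1.
Proof. now rewrite <- cis_opp, <- cis_plus, Rplus_opp_r, cis_0. Qed.

Lemma ev_padd p q j t : ev (padd p q) j t = (ev p j t + ev q j t)%C.
Proof.
revert q j; induction p as [|a p IH]; intros q j.
- apply C_eq; simpl; ring.
- destruct q as [|b q]; [apply C_eq; simpl; ring|].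
  pose proof (IH q (S j)) as E; unfold ev, Cplus in E; simpl in E.
  injection E; intros E1 E2.
  apply C_eq; cbn [padd ev ev_re_from ev_im_from fst snd Cplus];
    [rewrite E2|rewrite E1]; ring.
Qed.

Lemma ev_popp p j t : ev (popp p) j t = (- ev p j t)%C.
Proof.
revert j; induction p as [|a p IH]; intros j; [apply C_eq; simpl; ring|].
pose proof (IH (S j)) as E; unfold ev, Copp in E; simpl in E.
injection E; intros E1 E2.
apply C_eq; cbn [popp map ev ev_re_from ev_im_from fst snd Copp];
  fold (popp p); [rewrite E2|rewrite E1]; ring.
Qed.

Lemma ev_add_index p m j t : ev p (m + j) t = (cis (INR m * t) * ev p j t)%C.
Proof.
revert j; induction p as [|a p IH]; intros j; [apply C_eq; simpl; ring|].
pose proof (IH (S j)) as E; rewrite Nat.add_succ_r in E.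
unfold ev, Cmult in E; simpl in E; injection E; intros E1 E2.
apply C_eq; cbn [ev ev_re_from ev_im_from fst snd Cmult cis];
  [rewrite E2|rewrite E1]; rewrite plus_INR, Rmult_plus_distr_r;
  [rewrite cos_plus|rewrite sin_plus]; ring.
Qed.

Lemma ev_repeat0 m p j t : ev (repeat 0 m ++ p) j t = ev p (m + j) t.
Proof.
revert j; induction m as [|m IH]; intros j; [easy|].
replace (S m + j)%nat with (m + S j)%nat by lia; rewrite <- IH.
apply C_eq; simpl; ring.
Qed.

Lemma ev_pshift m p t : ev (pshift m p) 0 t = (cis (INR m * t) * ev p 0 t)%C.
Proof. unfold pshift; rewrite ev_repeat0; apply ev_add_index. Qed.

Lemma rsval_step a k t : rsval a (S k) t =
  (rsval false k t + RtoC (had a true) * (cis (2 ^ k * t) * rsval true k t))%C.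
Proof.
replace (2 ^ k) with (INR (2 ^ k)) by (rewrite pow_INR; reflexivity).
unfold rsval; simpl RS; destruct (RS k) as [p q]; simpl fst; simpl snd.
destruct a; rewrite ev_padd, ?ev_popp, ev_pshift; unfold had; simpl andb; cbv iota.
- replace (RtoC (-1)) with (- RtoC 1)%C by (apply C_eq; simpl; ring); ring.
- ring.
Qed.

Definition lwt (c : letter) : Z := (Z.b2z (fst c) - Z.b2z (snd c))%Z.

(** The vector is multiplied by diag(1, cis x) and then by H / sqrt 2; its density matrix is
    conjugated accordingly. Real parts keep [walsh] real-valued, and the free factor z lets the
    other tensor factors be carried along in [tens_step]. *)
Lemma dens_step k t c z :
  Re (z * dens (S k) t c) = lsum (fun c' => hmat c c' *
    Re (z * (cis (IZR (lwt c') * (2 ^ k * t)) * dens k t c'))).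
Proof.
unfold dens; rewrite !rsval_step; set (x := 2 ^ k * t).
pose proof (cis_conj x) as Hx.
unfold lsum, lwt; cbn [fst snd Z.b2z].
replace (IZR (0 - 0) * x) with 0 by (simpl; ring).
replace (IZR (1 - 1) * x) with 0 by (simpl; ring).
replace (IZR (1 - 0) * x) with x by (simpl; ring).
replace (IZR (0 - 1) * x) with (- x) by (simpl; ring).
rewrite cis_0, cis_opp.
unfold Cconj, Cmult, cis, RtoC in Hx; simpl in Hx; injection Hx; intros _ H1.
destruct (rsval false k t) as [p1 p2], (rsval true k t) as [q1 q2], z as [z1 z2].
assert (H2 : / 2 ^ S (S k) = / 2 ^ S k / 2).
{ simpl; field; apply pow_nonzero; lra. }
rewrite H2; set (r := / 2 ^ S k).
unfold cis in *; set (co := cos x) in *; set (si := sin x) in *.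
assert (H3 : si * si = 1 - co * co) by lra.
destruct c as [[] []]; unfold hmat, had; simpl;
  unfold Rdiv; ring_simplify;
  replace (si ^ 2) with (1 - co ^ 2) by (simpl; lra); field.
Qed.

Lemma tens_step k t w z :
  Re (z * tens (S k) t w) = walsh w (fun v =>
    Re (z * (cis (IZR (wt v) * (2 ^ k * t)) * tens k t v))).
Proof.
revert z; induction w as [|c w IH]; intros z.
- cbn [tens walsh wt cntA cntB fold_right].
  replace (IZR (wt nil) * (2 ^ k * t)) with 0 by (unfold wt; simpl; ring).
  rewrite cis_0; f_equal; ring.
(* The head factor is absorbed into z for the tail; then the tail is absorbed into z for the
   head. *)
- cbn [tens walsh]; rewrite Cmult_assoc, IH.
  rewrite (walsh_ext w _ (fun v => lsum (fun c' => hmat c c' *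
    Re (z * (cis (IZR (wt (c' :: v)) * (2 ^ k * t)) * tens k t (c' :: v)))))).
  + apply (walsh_lsum w (hmat c) (fun c' v =>
      Re (z * (cis (IZR (wt (c' :: v)) * (2 ^ k * t)) * tens k t (c' :: v))))).
  + intros v _; set (y := (cis (IZR (wt v) * (2 ^ k * t)) * tens k t v)%C).
    replace (z * dens (S k) t c * y)%C with ((z * y) * dens (S k) t c)%C by ring.
    rewrite dens_step; apply lsum_ext; intros c'; do 2 f_equal.
    rewrite wt_cons, plus_IZR, Rmult_plus_distr_r, cis_plus.
    fold (lwt c'); cbn [tens]; unfold y; ring.
Qed.

(** * Continuity in the angle and means over the circle *)

Definition cont (f : R -> R) : Prop := forall t, continuous f t.
Definition ccont (f : R -> Complex.C) : Prop :=
  cont (fun t => Re (f t)) /\ cont (fun t => Im (f t)).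

Lemma cont_const c : cont (fun _ => c).
Proof. intros t; apply continuous_const. Qed.
Lemma cont_plus f g : cont f -> cont g -> cont (fun t => f t + g t).
Proof. intros Hf Hg t; now apply (continuous_plus f g). Qed.
Lemma cont_mult f g : cont f -> cont g -> cont (fun t => f t * g t).
Proof. intros Hf Hg t; now apply (continuous_mult f g). Qed.
Lemma cont_opp f : cont f -> cont (fun t => - f t).
Proof. intros Hf t; now apply (continuous_opp f). Qed.
Lemma cont_minus f g : cont f -> cont g -> cont (fun t => f t - g t).
Proof. intros Hf Hg t; now apply (continuous_minus f g). Qed.
Lemma cont_pow f n : cont f -> cont (fun t => f t ^ n).
Proof.
intros Hf; induction n as [|n IH]; simpl; [apply cont_const|now apply cont_mult].
Qed.
Lemma cont_cos_lin a : cont (fun t => cos (a * t)).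
Proof.
intros t; apply (ex_derive_continuous (V := R_NormedModule)); auto_derive; auto.
Qed.
Lemma cont_sin_lin a : cont (fun t => sin (a * t)).
Proof.
intros t; apply (ex_derive_continuous (V := R_NormedModule)); auto_derive; auto.
Qed.
Lemma cont_ext f g : (forall t, f t = g t) -> cont f -> cont g.
Proof. intros H Hf t; now apply (continuous_ext f). Qed.

Lemma ccont_mult f g : ccont f -> ccont g -> ccont (fun t => (f t * g t)%C).
Proof.
intros [H1 H2] [H3 H4]; split; simpl.
- apply cont_minus; now apply cont_mult.
- apply cont_plus; now apply cont_mult.
Qed.

Lemma ccont_conj f : ccont f -> ccont (fun t => Cconj (f t)).
Proof. intros [H1 H2]; split; simpl; [easy|now apply cont_opp]. Qed.

Lemma ccont_const z : ccont (fun _ => z).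
Proof. split; apply cont_const. Qed.

Lemma ccont_cis a : ccont (fun t => cis (a * t)).
Proof. split; simpl; [apply cont_cos_lin|apply cont_sin_lin]. Qed.

Lemma ccont_ev p j : ccont (ev p j).
Proof.
revert j; induction p as [|a p IH]; intros j; [split; apply (cont_const 0)|].
destruct (IH (S j)) as [H1 H2]; split; simpl in *.
- apply cont_plus; [|easy]; apply cont_mult; [apply cont_const|apply cont_cos_lin].
- apply cont_plus; [|easy]; apply cont_mult; [apply cont_const|apply cont_sin_lin].
Qed.

Lemma ccont_dens k c : ccont (fun t => dens k t c).
Proof.
apply ccont_mult; [apply ccont_const|].
apply ccont_mult; [|apply ccont_conj]; apply ccont_ev.
Qed.

Lemma ccont_tens k w : ccont (fun t => tens k t w).
Proof.
induction w as [|c w IH]; simpl; [apply ccont_const|].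
apply ccont_mult; [apply ccont_dens|easy].
Qed.

Definition mean (f : R -> R) : R := RInt f 0 (2 * PI) / (2 * PI).

Lemma cont_ex_RInt f a b : cont f -> ex_RInt f a b.
Proof. intros Hf; apply (ex_RInt_continuous (V := R_CompleteNormedModule)); auto. Qed.

Lemma mean_ext f g : (forall t, f t = g t) -> mean f = mean g.
Proof. intros H; unfold mean; f_equal; apply RInt_ext; auto. Qed.

Lemma two_PI_pos : 0 < 2 * PI.
Proof. pose proof PI_RGT_0; lra. Qed.

Lemma mean_const c : mean (fun _ => c) = c.
Proof.
unfold mean; rewrite RInt_const; unfold scal; simpl; unfold mult; simpl.
field; apply PI_neq0.
Qed.

Lemma mean_plus f g :
  ex_RInt f 0 (2 * PI) -> ex_RInt g 0 (2 * PI) ->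
  mean (fun t => f t + g t) = mean f + mean g.
Proof.
intros Hf Hg; unfold mean.
replace (RInt (fun t => f t + g t) 0 (2 * PI))
  with (RInt f 0 (2 * PI) + RInt g 0 (2 * PI)); [field; apply PI_neq0|].
symmetry; apply (RInt_plus f g); assumption.
Qed.

Lemma mean_scal a f : ex_RInt f 0 (2 * PI) -> mean (fun t => a * f t) = a * mean f.
Proof.
intros Hf; unfold mean.
replace (RInt (fun t => a * f t) 0 (2 * PI))
  with (a * RInt f 0 (2 * PI)); [field; apply PI_neq0|].
symmetry; apply (RInt_scal f _ _ a); assumption.
Qed.

Lemma mean_le f g :
  ex_RInt f 0 (2 * PI) -> ex_RInt g 0 (2 * PI) ->
  (forall t, f t <= g t) -> mean f <= mean g.
Proof.
intros Hf Hg H; pose proof two_PI_pos; unfold mean.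
apply Rmult_le_compat_r; [left; now apply Rinv_0_lt_compat|].
apply RInt_le; auto; lra.
Qed.

Lemma cont_walsh w (g : R -> word -> R) :
  (forall v, cont (fun t => g t v)) -> cont (fun t => walsh w (g t)).
Proof.
revert g; induction w as [|c w IH]; intros g H; cbn [walsh]; [apply H|].
unfold lsum; repeat apply cont_plus; (apply cont_mult; [apply cont_const|]);
  match goal with |- cont (fun t => walsh _ (fun v => g t (?c' :: v))) =>
    apply (IH (fun t v => g t (c' :: v))); intros v; apply H end.
Qed.

Lemma mean_walsh w (g : R -> word -> R) :
  (forall v, cont (fun t => g t v)) ->
  mean (fun t => walsh w (g t)) = walsh w (fun v => mean (fun t => g t v)).
Proof.
revert g; induction w as [|c w IH]; intros g H; cbn [walsh]; [easy|].
assert (HH : forall c', cont (fun t => hmat c c' * walsh w (fun v => g t (c' :: v)))).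
{ intros c'; apply cont_mult; [apply cont_const|].
  apply (cont_walsh w (fun t v => g t (c' :: v))); intros v; apply H. }
assert (HE : forall c', mean (fun t => hmat c c' * walsh w (fun v => g t (c' :: v)))
  = hmat c c' * walsh w (fun v => mean (fun t => g t (c' :: v)))).
{ intros c'; rewrite mean_scal.
  - f_equal; apply (IH (fun t v => g t (c' :: v))); intros v; apply H.
  - apply cont_ex_RInt, (cont_walsh w (fun t v => g t (c' :: v))); intros v; apply H. }
unfold lsum; rewrite !mean_plus, !HE; try easy;
  apply cont_ex_RInt; repeat apply cont_plus; apply HH.
Qed.

Lemma mean_cos l : l <> 0%Z -> mean (fun t => cos (IZR l * t)) = 0.
Proof.
intros Hl; assert (Hl' : IZR l <> 0) by now apply not_0_IZR.
unfold mean.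
rewrite (is_RInt_unique _ _ _ (minus (sin (IZR l * (2 * PI)) / IZR l)
  (sin (IZR l * 0) / IZR l))).
- replace (IZR l * (2 * PI)) with (IZR (2 * l) * PI) by (rewrite mult_IZR; ring).
  rewrite sin_eq_0_1 by now exists (2 * l)%Z.
  rewrite Rmult_0_r, sin_0; unfold minus, plus, opp; simpl; field.
  split; [easy|apply PI_neq0].
- apply (is_RInt_derive (fun t => sin (IZR l * t) / IZR l)).
  + intros x _; auto_derive; [easy|field; easy].
  + intros x _; apply cont_cos_lin.
Qed.

(** Taking [Re] loses nothing: the entries are Laurent polynomials in e^(it) with real
    coefficients. *)
Definition fourier (k : nat) (l : Z) (w : word) : R :=
  mean (fun t => Re (cis (- (IZR l * 2 ^ k) * t) * tens k t w)).

Lemma tens_0 w : exists r, forall t, tens 0 t w = RtoC r.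
Proof.
induction w as [|c w [r Hr]]; [exists 1; easy|].
exists (/ 2 * r).
assert (H : forall s, dens 0 s c = RtoC (/ 2)).
{ intros s.
  assert (Hs : forall b, rsval b 0 s = RtoC 1).
  { intros []; unfold rsval, ev; cbn [RS fst snd ev_re_from ev_im_from INR];
      rewrite Rmult_0_l, cos_0, sin_0; apply C_eq; simpl; ring. }
  unfold dens; rewrite !Hs; apply C_eq; simpl; field. }
intros t; simpl; rewrite H, Hr; apply C_eq; simpl; ring.
Qed.

Lemma fourier_walk n : walk n fourier.
Proof.
split.
- intros l w _ Hl; unfold fourier.
  destruct (tens_0 w) as [r Hr].
  rewrite (mean_ext _ (fun t => r * cos (IZR l * t))).
  + rewrite mean_scal, mean_cos; [ring|easy|apply cont_ex_RInt, cont_cos_lin].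
  + intros t; rewrite Hr; simpl.
    replace (- (IZR l * 1) * t) with (- (IZR l * t)) by ring.
    rewrite cos_neg; ring.
- intros k l w _; unfold fourier.
  rewrite <- (mean_walsh w (fun t b =>
    Re (cis (- (IZR (2 * l - wt b) * 2 ^ k) * t) * tens k t b))).
  + apply mean_ext; intros t; rewrite tens_step; apply walsh_ext; intros v _.
    (* Frequency l at scale 2^(k+1), shifted by the phase of weight wt v, is frequency 2l - wt v at
       scale 2^k. *)
    f_equal; rewrite Cmult_assoc, <- cis_plus; do 2 f_equal.
    rewrite minus_IZR, mult_IZR; simpl; ring.
  + intros v.
    exact (proj1 (ccont_mult (fun t => cis (- (IZR (2 * l - wt v) * 2 ^ k) * t))
      (fun t => tens k t v) (ccont_cis _) (ccont_tens k v))).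
Qed.

(** * Bernstein moments *)

(** The common value of all entries of the n-th tensor power with a row bits and b column bits
    set. *)
Definition mono (n a b k : nat) (t : R) : Complex.C :=
  (RtoC (/ 2 ^ S k) ^ n *
   (rsval false k t ^ (n - a) * rsval true k t ^ a *
    (Cconj (rsval false k t) ^ (n - b) * Cconj (rsval true k t) ^ b)))%C.

Lemma cnt_bound (w : word) :
  (0 <= cntA w <= Z.of_nat (length w))%Z /\ (0 <= cntB w <= Z.of_nat (length w))%Z.
Proof.
induction w as [|[a b] w IH]; cbn [length cntA cntB fold_right fst snd]; [lia|].
fold (cntA w) (cntB w); destruct a, b; cbn [Z.b2z]; lia.
Qed.

Lemma tens_mono (k : nat) (t : R) (w : word) :
  tens k t w = mono (length w) (Z.to_nat (cntA w)) (Z.to_nat (cntB w)) k t.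
Proof.
induction w as [|[a b] w IH].
- unfold mono; simpl; ring.
- pose proof (cnt_bound w) as [HA HB].
  cbn [tens]; rewrite IH; unfold dens, mono.
  cbn [length cntA cntB fold_right fst snd]; fold (cntA w) (cntB w).
  set (n := length w) in *.
  destruct a, b; cbn [Z.b2z]; rewrite ?Z.add_0_l;
  rewrite ?Z2Nat.inj_add by lia; change (Z.to_nat 1) with 1%nat;
  rewrite ?Nat.add_1_l, ?Nat.sub_succ;
  rewrite ?(Nat.sub_succ_l (Z.to_nat (cntA w)) n) by lia;
  rewrite ?(Nat.sub_succ_l (Z.to_nat (cntB w)) n) by lia;
  rewrite !Cpow_S; ring.
Qed.

Lemma word_of_counts (n a b : nat) : (a <= n)%nat -> (b <= n)%nat ->
  exists w, length w = n /\ cntA w = Z.of_nat a /\ cntB w = Z.of_nat b.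
Proof.
revert a b; induction n as [|n IH]; intros a b Ha Hb.
- exists nil; simpl; lia.
- destruct (IH (Nat.pred a) (Nat.pred b)) as (w & H1 & H2 & H3); [lia|lia|].
  exists ((Nat.ltb 0 a, Nat.ltb 0 b) :: w).
  cbn [length cntA cntB fold_right fst snd]; fold (cntA w) (cntB w).
  destruct a, b; cbn [Nat.ltb Nat.leb Z.b2z Nat.pred] in *; lia.
Qed.

(** Integer arguments match [wtconj_counts], whose shifts may leave the range 0..n; such values get
    coefficient 0 there. *)
Definition mix (n k : nat) (A B : Z) : R :=
  mean (fun t => Re (mono n (Z.to_nat A) (Z.to_nat B) k t)).

Lemma fourier_mix (k : nat) (w : word) :
  fourier k 0 w = mix (length w) k (cntA w) (cntB w).
Proof.
apply mean_ext; intros t; rewrite <- tens_mono.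
replace (- (0 * 2 ^ k) * t) with 0 by ring; rewrite cis_0; f_equal; ring.
Qed.

Lemma mix_offdiag (n a b : nat) : (a <= n)%nat -> (b <= n)%nat -> a <> b ->
  is_lim_seq (fun k => mix n k (Z.of_nat a) (Z.of_nat b)) 0.
Proof.
intros Ha Hb Hab.
destruct (word_of_counts n a b Ha Hb) as (w & H1 & H2 & H3).
apply (is_lim_seq_ext (fun k => fourier k 0 w)).
{ intros k; now rewrite fourier_mix, H1, H2, H3. }
apply (walk_zero n fourier (fourier_walk n)); [easy|unfold wt; lia].
Qed.

(** At a word with counts (j + 1, j), [wtconj_counts] involves four neighbours: (j, j) and (j + 1, j
    + 1) are diagonal, while (j + 2, j) and (j + 1, j - 1) decay by [mix_offdiag]. *)
Lemma mix_diag_step (n j : nat) : (j < n)%nat ->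
  is_lim_seq (fun k => INR (S j) * mix n k (Z.of_nat j) (Z.of_nat j)
    - INR (n - j) * mix n k (Z.of_nat (S j)) (Z.of_nat (S j))) 0.
Proof.
intros Hj.
destruct (word_of_counts n (S j) j) as (w & H1 & H2 & H3); [lia|lia|].
assert (Hoff1 : is_lim_seq (fun k =>
  INR (n - S j) * mix n k (Z.of_nat (S (S j))) (Z.of_nat j)) 0).
{ destruct (le_lt_dec (S (S j)) n) as [H|H].
  - apply is_lim_seq_0_scal, mix_offdiag; lia.
  - replace (n - S j)%nat with 0%nat by lia.
    apply (is_lim_seq_ext (fun _ => 0)); [|apply is_lim_seq_const].
    intros k; simpl; ring. }
assert (Hoff2 : is_lim_seq (fun k =>
  - INR j * mix n k (Z.of_nat (S j)) (Z.of_nat (Nat.pred j))) 0).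
{ apply is_lim_seq_0_scal, mix_offdiag; lia. }
apply (is_lim_seq_ext (fun k => -2 * wtconj (fourier k 0%Z) w +
  (-1) * (INR (n - S j) * mix n k (Z.of_nat (S (S j))) (Z.of_nat j)
   + - INR j * mix n k (Z.of_nat (S j)) (Z.of_nat (Nat.pred j))))).
- intros k.
  (* The two functions agree only on words of length n; passing through [walsh] reduces the
     comparison to such words. *)
  assert (E : wtconj (fourier k 0%Z) w =
    wtconj (fun v => mix n k (cntA v) (cntB v)) w).
  { transitivity (walsh w (fun v => walsh v (wtconj (fourier k 0%Z))));
      [symmetry; apply walsh_invol|].
    rewrite <- (walsh_invol w (wtconj (fun v => mix n k (cntA v) (cntB v)))).
    apply walsh_ext; intros v Hv; rewrite !walsh_wtconj; f_equal.
    apply walsh_ext; intros u Hu; rewrite fourier_mix; f_equal; lia. }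
  rewrite E, wtconj_counts, H1, H2, H3.
  replace (Z.of_nat (S j) - 1)%Z with (Z.of_nat j) by lia.
  replace (Z.of_nat (S j) + 1)%Z with (Z.of_nat (S (S j))) by lia.
  replace (Z.of_nat j + 1)%Z with (Z.of_nat (S j)) by lia.
  rewrite <- !Nat2Z.inj_sub by lia; rewrite <- !INR_IZR_INZ.
  destruct j as [|j].
  + change (INR 0) with 0; field.
  + replace (Z.of_nat (S j) - 1)%Z with (Z.of_nat j) by lia.
    simpl Nat.pred; field.
- apply is_lim_seq_0_plus; apply is_lim_seq_0_scal.
  + now apply (walk_wtconj n fourier (fourier_walk n)).
  + now apply is_lim_seq_0_plus.
Qed.

Definition nrm (z : Complex.C) : R := fst z ^ 2 + snd z ^ 2.

Lemma nrm_conj (z : Complex.C) : (z * Cconj z)%C = RtoC (nrm z).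
Proof. apply C_eq; unfold nrm; simpl; ring. Qed.

(** Since |z| = 1, the parallelogram law doubles the sum at each step. *)
Lemma rsval_parallelogram (k : nat) (t : R) :
  nrm (rsval false k t) + nrm (rsval true k t) = 2 ^ S k.
Proof.
induction k as [|k IH].
- unfold nrm, rsval, ev; cbn [RS fst snd ev_re_from ev_im_from INR].
  rewrite Rmult_0_l, cos_0, sin_0; ring.
- rewrite !rsval_step; change (2 ^ S (S k)) with (2 * 2 ^ S k); rewrite <- IH.
  pose proof (sin2_cos2 (2 ^ k * t)) as H; unfold Rsqr in H.
  destruct (rsval false k t) as [p1 p2], (rsval true k t) as [q1 q2].
  unfold nrm, had, cis; simpl.
  set (c := cos _) in *; set (s := sin _) in *.
  transitivity (2 * (p1 ^ 2 + p2 ^ 2) + 2 * (s * s + c * c) * (q1 ^ 2 + q2 ^ 2));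
    [ring|rewrite H; ring].
Qed.

Lemma rs_normsq_nrm (k : nat) (t : R) :
  rs_normsq k t = / 2 ^ S k * nrm (rsval false k t).
Proof. unfold rs_normsq, Rdiv; now rewrite Rmult_comm. Qed.

Lemma rs_normsq_compl (k : nat) (t : R) :
  1 - rs_normsq k t = / 2 ^ S k * nrm (rsval true k t).
Proof.
rewrite rs_normsq_nrm; pose proof (rsval_parallelogram k t) as H.
replace (nrm (rsval true k t)) with (2 ^ S k - nrm (rsval false k t)) by lra.
field; apply pow_nonzero; lra.
Qed.

Lemma rs_normsq_bound (k : nat) (t : R) : 0 <= rs_normsq k t <= 1.
Proof.
assert (Hp : 0 < / 2 ^ S k) by (apply Rinv_0_lt_compat, pow_lt; lra).
assert (Hn : forall z, 0 <= nrm z).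
{ intros z; unfold nrm; pose proof (pow2_ge_0 (fst z)); pose proof (pow2_ge_0 (snd z)); lra. }
pose proof (rs_normsq_compl k t); pose proof (rs_normsq_nrm k t).
pose proof (Rmult_le_pos _ _ (Rlt_le _ _ Hp) (Hn (rsval false k t))).
pose proof (Rmult_le_pos _ _ (Rlt_le _ _ Hp) (Hn (rsval true k t))).
lra.
Qed.

Lemma cont_rs_normsq (k : nat) : cont (rs_normsq k).
Proof.
destruct (ccont_ev (RSP k) 0) as [H1 H2].
apply (cont_ext (fun t => / 2 ^ S k *
  (Re (ev (RSP k) 0 t) ^ 2 + Im (ev (RSP k) 0 t) ^ 2))).
- intros t; unfold rs_normsq, modsq_unit, ev; simpl; unfold Rdiv; ring.
- apply cont_mult; [apply cont_const|]; apply cont_plus; now apply cont_pow.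
Qed.

Lemma mono_diag (n j k : nat) (t : R) : (j <= n)%nat ->
  Re (mono n j j k t) = rs_normsq k t ^ (n - j) * (1 - rs_normsq k t) ^ j.
Proof.
intros Hj; rewrite rs_normsq_compl, rs_normsq_nrm; unfold mono.
replace (RtoC (/ 2 ^ S k) ^ n)%C
  with (RtoC (/ 2 ^ S k) ^ (n - j) * RtoC (/ 2 ^ S k) ^ j)%C
  by (rewrite <- Cpow_add_r; f_equal; lia).
transitivity (Re ((RtoC (/ 2 ^ S k) * (rsval false k t * Cconj (rsval false k t))) ^ (n - j)
  * (RtoC (/ 2 ^ S k) * (rsval true k t * Cconj (rsval true k t))) ^ j)%C).
- f_equal; rewrite !Cpow_mult_l; ring.
- rewrite !nrm_conj, <- !RtoC_mult, <- !RtoC_pow, <- RtoC_mult; reflexivity.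
Qed.

Definition bern (n j : nat) (x : R) : R := Binomial.C n j * x ^ j * (1 - x) ^ (n - j).

Lemma cont_bern n j k : cont (fun t => bern n j (rs_normsq k t)).
Proof.
apply cont_mult; [apply cont_mult; [apply cont_const|]|]; apply cont_pow;
  [|apply cont_minus; [apply cont_const|]]; apply cont_rs_normsq.
Qed.

(** The index is reversed because j counts the factors from Q_k, that is, the power of
    [1 - rs_normsq k t]. *)
Lemma mix_diag (n j k : nat) : (j <= n)%nat ->
  Binomial.C n j * mix n k (Z.of_nat j) (Z.of_nat j) =
  mean (fun t => bern n (n - j) (rs_normsq k t)).
Proof.
intros Hj; unfold mix; rewrite !Nat2Z.id.
rewrite (mean_ext (fun t => Re (mono n j j k t)) (fun t =>
  rs_normsq k t ^ (n - j) * (1 - rs_normsq k t) ^ j)).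
2:{ intros t; now apply mono_diag. }
rewrite <- mean_scal.
- apply mean_ext; intros t; unfold bern; rewrite <- pascal_step1 by easy.
  replace (n - (n - j))%nat with j by lia; ring.
- apply cont_ex_RInt; apply cont_mult; apply cont_pow;
  [|apply cont_minus; [apply cont_const|]]; apply cont_rs_normsq.
Qed.

Lemma cont_sum (g : nat -> R -> R) (n : nat) : (forall j, cont (g j)) ->
  cont (fun t => sum_f_R0 (fun j => g j t) n).
Proof.
intros H; induction n as [|n IH]; simpl; [apply H|now apply cont_plus].
Qed.

Lemma mean_sum (g : nat -> R -> R) (n : nat) : (forall j, cont (g j)) ->
  mean (fun t => sum_f_R0 (fun j => g j t) n) = sum_f_R0 (fun j => mean (g j)) n.
Proof.
intros H; induction n as [|n IH]; simpl; [easy|].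
rewrite mean_plus, IH; [easy| |]; apply cont_ex_RInt; [now apply cont_sum|easy].
Qed.

Lemma bern_sum (n : nat) (x : R) : sum_f_R0 (fun j => bern n j x) n = 1.
Proof.
unfold bern; rewrite <- binomial.
replace (x + (1 - x)) with 1 by ring; apply pow1.
Qed.

Lemma is_lim_seq_sum0 (u : nat -> nat -> R) (n : nat) :
  (forall j, (j <= n)%nat -> is_lim_seq (u j) 0) ->
  is_lim_seq (fun k => sum_f_R0 (fun j => u j k) n) 0.
Proof.
induction n as [|n IH]; intros H; simpl; [now apply H|].
apply is_lim_seq_0_plus; [apply IH; intros j Hj|]; apply H; lia.
Qed.

Lemma bern_consecutive (n j : nat) : (j < n)%nat ->
  is_lim_seq (fun k => mean (fun t => bern n j (rs_normsq k t))
    - mean (fun t => bern n (S j) (rs_normsq k t))) 0.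
Proof.
intros Hj; set (i := (n - S j)%nat).
(* Since C(n, i+1) = C(n, i) (n - i) / (i + 1), this factor turns the relation of [mix_diag_step]
   into a difference of Bernstein moments. *)
apply (is_lim_seq_ext (fun k => - Binomial.C n i / INR (S i) *
  (INR (S i) * mix n k (Z.of_nat i) (Z.of_nat i)
    - INR (n - i) * mix n k (Z.of_nat (S i)) (Z.of_nat (S i))))).
- intros k.
  replace (mean (fun t => bern n j (rs_normsq k t)))
    with (mean (fun t => bern n (n - S i) (rs_normsq k t)))
    by (f_equal; replace (n - S i)%nat with j by (unfold i; lia); easy).
  replace (mean (fun t => bern n (S j) (rs_normsq k t)))
    with (mean (fun t => bern n (n - i) (rs_normsq k t)))
    by (replace (n - i)%nat with (S j) by (unfold i; lia); easy).
  rewrite <- !mix_diag by (unfold i; lia).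
  rewrite (pascal_step3 n i) by (unfold i; lia).
  field; apply not_0_INR; lia.
- apply is_lim_seq_0_scal, mix_diag_step; unfold i; lia.
Qed.

(* Asymptotically all Bernstein moments of degree [n] agree, and they add up to 1. *)
Lemma bern_limit (n j : nat) : (j <= n)%nat ->
  is_lim_seq (fun k => mean (fun t => bern n j (rs_normsq k t))) (1 / (INR n + 1)).
Proof.
set (m := fun j k => mean (fun t => bern n j (rs_normsq k t))).
assert (H0 : forall i, (i <= n)%nat -> is_lim_seq (fun k => m i k - m 0%nat k) 0).
{ induction i as [|i IH]; intros Hi.
  - apply (is_lim_seq_ext (fun _ => 0)); [intros k; ring|apply is_lim_seq_const].
  - apply (is_lim_seq_ext (fun k => (m i k - m 0%nat k) + (-1) * (m i k - m (S i) k)));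
      [intros k; ring|].
    apply is_lim_seq_0_plus; [apply IH; lia|].
    apply is_lim_seq_0_scal, bern_consecutive; lia. }
assert (Hn : INR n + 1 <> 0) by (pose proof (pos_INR n); lra).
assert (Hm0 : is_lim_seq (fun k => m 0%nat k - 1 / (INR n + 1)) 0).
(* The sum of the differences equals 1 - (n + 1) [m 0 k]. *)
{ apply (is_lim_seq_ext (fun k => - / (INR n + 1) *
    sum_f_R0 (fun j => m j k - m 0%nat k) n)).
  - intros k; rewrite minus_sum, sum_cte, S_INR.
    unfold m at 1; rewrite <- (mean_sum (fun j t => bern n j (rs_normsq k t)));
      [|intros i; apply cont_bern].
    rewrite (mean_ext _ (fun _ => 1)), mean_const by (intros t; apply bern_sum).
    field; easy.
  - now apply is_lim_seq_0_scal, is_lim_seq_sum0. }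
intros Hj.
apply (is_lim_seq_ext (fun k => (m j k - m 0%nat k) +
  (m 0%nat k - 1 / (INR n + 1)) + 1 / (INR n + 1))); [intros k; unfold m; ring|].
replace (Finite (1 / (INR n + 1))) with (Finite (0 + 1 / (INR n + 1)))
  by (f_equal; ring).
apply is_lim_seq_plus'; [|apply is_lim_seq_const].
apply is_lim_seq_0_plus; [now apply H0|easy].
Qed.

(** * Convergence in distribution *)

Fixpoint peval (p : list R) (x : R) : R :=
  match p with
  | nil => 0
  | c :: p' => c + x * peval p' x
  end.

Definition ispoly (f : R -> R) : Prop := exists p, forall x, f x = peval p x.

Lemma peval_padd p q x : peval (padd p q) x = peval p x + peval q x.
Proof.
revert q; induction p as [|a p IH]; intros q; simpl; [ring|].
destruct q as [|b q]; simpl; [ring|rewrite IH; ring].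
Qed.

Lemma peval_scal c p x : peval (map (Rmult c) p) x = c * peval p x.
Proof. induction p as [|a p IH]; simpl; [ring|rewrite IH; ring]. Qed.

Lemma ispoly_const c : ispoly (fun _ => c).
Proof. exists [c]; intros x; simpl; ring. Qed.

Lemma ispoly_id : ispoly (fun x => x).
Proof. exists [0; 1]; intros x; simpl; ring. Qed.

Lemma ispoly_plus f g : ispoly f -> ispoly g -> ispoly (fun x => f x + g x).
Proof.
intros [p Hp] [q Hq]; exists (padd p q); intros x; now rewrite peval_padd, Hp, Hq.
Qed.

Lemma ispoly_mult f g : ispoly f -> ispoly g -> ispoly (fun x => f x * g x).
Proof.
intros [p Hp] [q Hq].
assert (H : exists r, forall x, peval r x = peval p x * peval q x).
{ clear Hp; induction p as [|c p [r Hr]].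
  - exists nil; intros x; simpl; ring.
  - exists (padd (map (Rmult c) q) (0 :: r)); intros x.
    rewrite peval_padd, peval_scal; simpl; rewrite Hr; ring. }
destruct H as [r Hr]; exists r; intros x; now rewrite Hr, Hp, Hq.
Qed.

Lemma peval_factor p r : exists q, length q = Nat.pred (length p) /\
  forall x, peval p x = peval p r + (x - r) * peval q x.
Proof.
induction p as [|c p [q [H1 H2]]].
- exists nil; split; [easy|intros x; simpl; ring].
- destruct p as [|c' p].
  + exists nil; split; [easy|intros x; simpl; ring].
  + exists (peval (c' :: p) r :: q); split; [simpl in *; lia|].
    intros x; cbn [peval]; cbn [peval] in H2; rewrite H2; ring.
Qed.

(** Induction on the number of coefficients: a root is factored out by [peval_factor], and without
    roots the empty list serves. *)
Lemma poly_zeros f : ispoly f ->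
  (forall x, f x = 0) \/ exists L, forall x, f x = 0 -> In x L.
Proof.
intros [p Hp].
assert (H : forall n p, length p = n ->
  (forall x, peval p x = 0) \/ exists L, forall x, peval p x = 0 -> In x L).
{ clear; induction n as [|n IH]; intros p Hn.
  - destruct p; [now left|discriminate].
  - destruct (classic (exists r, peval p r = 0)) as [[r Hr]|Hno].
    + destruct (peval_factor p r) as [q [H1 H2]].
      destruct (IH q) as [H|[L HL]]; [lia| |].
      * left; intros x; rewrite H2, Hr, H; ring.
      * right; exists (r :: L); intros x Hx; rewrite H2, Hr, Rplus_0_l in Hx.
        destruct (Rmult_integral _ _ Hx) as [H|H]; [left; lra|right; now apply HL].
    + right; exists nil; intros x Hx; apply Hno; now exists x. }
destruct (H _ p eq_refl) as [H0|[L HL]].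
- left; intros x; now rewrite Hp.
- right; exists L; intros x Hx; apply HL; now rewrite <- Hp.
Qed.

(** These are the Chebyshev polynomials T_j and U_(j-1), the latter being 0 for j = 0; the addition
    formulas give their recursion. *)
Lemma chebyshev j : exists T U, ispoly T /\ ispoly U /\
  forall t, cos (INR j * t) = T (cos t) /\ sin (INR j * t) = sin t * U (cos t).
Proof.
induction j as [|j (T & U & HT & HU & H)].
- exists (fun _ => 1), (fun _ => 0); split; [apply ispoly_const|].
  split; [apply ispoly_const|]; intros t.
  change (INR 0) with 0; rewrite Rmult_0_l, cos_0, sin_0; lra.
- exists (fun x => T x * x + (x * x + -1) * U x), (fun x => U x * x + T x).
  split; [|split].
  + apply ispoly_plus; [apply ispoly_mult; [easy|apply ispoly_id]|].
    apply ispoly_mult; [|easy].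
    apply ispoly_plus; [apply ispoly_mult; apply ispoly_id|apply ispoly_const].
  + apply ispoly_plus; [apply ispoly_mult; [easy|apply ispoly_id]|easy].
  + intros t; destruct (H t) as [H1 H2].
    rewrite S_INR, Rmult_plus_distr_r, Rmult_1_l, cos_plus, sin_plus, H1, H2.
    pose proof (sin2_cos2 t) as E; unfold Rsqr in E.
    split; [|ring].
    replace (cos t * cos t + -1) with (- (sin t * sin t)) by lra; ring.
Qed.

Lemma ev_cos p j : exists T U, ispoly T /\ ispoly U /\
  forall t, ev_re_from p j t = T (cos t) /\ ev_im_from p j t = sin t * U (cos t).
Proof.
revert j; induction p as [|c p IH]; intros j.
- exists (fun _ => 0), (fun _ => 0); split; [apply ispoly_const|].
  split; [apply ispoly_const|]; intros t; simpl; lra.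
- destruct (IH (S j)) as (T & U & HT & HU & H).
  destruct (chebyshev j) as (T' & U' & HT' & HU' & H').
  exists (fun x => c * T' x + T x), (fun x => c * U' x + U x).
  split; [|split].
  1, 2: apply ispoly_plus; [apply ispoly_mult; [apply ispoly_const|easy]|easy].
  intros t; destruct (H t) as [H1 H2], (H' t) as [H1' H2'].
  cbn [ev_re_from ev_im_from]; rewrite H1, H2, H1', H2'; split; ring.
Qed.

Lemma rs_normsq_cos k : exists T, ispoly T /\ forall t, rs_normsq k t = T (cos t).
Proof.
destruct (ev_cos (RSP k) 0) as (T & U & HT & HU & H).
exists (fun x => / 2 ^ S k * (T x * T x + (1 + -1 * (x * x)) * (U x * U x))); split.
- repeat (apply ispoly_mult || apply ispoly_plus || apply ispoly_const
    || apply ispoly_id || assumption).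
- intros t; destruct (H t) as [H1 H2].
  unfold rs_normsq, modsq_unit, Rdiv; rewrite H1, H2.
  pose proof (sin2_cos2 t) as E; unfold Rsqr in E.
  replace (1 + -1 * (cos t * cos t)) with (sin t * sin t) by lra; ring.
Qed.

(** A polynomial in cos t takes a given value at finitely many cos t or everywhere, and cos t
    determines t in [0, 2 PI] up to the reflection t -> 2 PI - t. *)
Lemma rs_normsq_level k y : (forall t, rs_normsq k t = y) \/
  exists L, forall t, 0 <= t <= 2 * PI -> rs_normsq k t = y -> In t L.
Proof.
destruct (rs_normsq_cos k) as (T & HT & H).
destruct (poly_zeros (fun x => T x + - y)) as [H0|[L HL]].
- apply ispoly_plus; [easy|apply ispoly_const].
- left; intros t; rewrite H; pose proof (H0 (cos t)); lra.
- right; exists (flat_map (fun x => [acos x; 2 * PI - acos x]) L).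
  intros t Ht Hy; apply in_flat_map; exists (cos t); split.
  + apply HL; rewrite <- H; lra.
  + destruct (Rle_lt_dec t PI) as [Hle|Hlt].
    * left; apply acos_cos; lra.
    * right; left;
      replace (cos t) with (cos (2 * PI - t)).
      { rewrite acos_cos by lra; ring. }
      rewrite <- (cos_neg t), <- (cos_period (- t) 1); f_equal; simpl; ring.
Qed.

(** Cut at each breakpoint lying inside. The hypothesis ranges over all breakpoint-free
    subintervals, so it passes to both pieces; the list need not be sorted. *)
Lemma ex_RInt_piecewise_const (f : R -> R) (Z : list R) a b : a <= b ->
  (forall c d, a <= c -> d <= b -> (forall z, In z Z -> ~ (c < z < d)) ->
    exists v, forall x, c < x < d -> f x = v) ->
  ex_RInt f a b.
Proof.
revert a b; induction Z as [|z Z IH]; intros a b Hab H.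
- destruct (H a b) as [v Hv]; [lra|lra|easy|].
  apply (ex_RInt_ext (fun _ => v)); [|apply ex_RInt_const].
  rewrite Rmin_left, Rmax_right by lra; intros x Hx; now rewrite Hv.
- destruct (classic (a < z < b)) as [Hz|Hz].
  + apply (ex_RInt_Chasles f a z b); apply IH; try lra; intros c d Hc Hd HZ;
      apply H; try lra; intros y [<-|Hy]; try lra; now apply HZ.
  + apply IH; [easy|]; intros c d Hc Hd HZ; apply H; try lra.
    intros y [<-|Hy]; [lra|now apply HZ].
Qed.

Lemma sign_const f (y c d : R) : cont f ->
  (forall x, c < x < d -> f x <> y) ->
  (forall x, c < x < d -> f x < y) \/ (forall x, c < x < d -> y < f x).
Proof.
intros Hf Hy.
assert (Hc : continuity f) by (intros x; apply continuity_pt_filterlim, Hf).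
destruct (classic (exists x, c < x < d /\ f x < y)) as [[x0 [Hx0 Hlt]]|Hno].
- left; intros x Hx; destruct (Rlt_le_dec (f x) y) as [H|H]; [easy|].
  destruct (IVT_gen f x0 x y Hc) as [z [Hz1 Hz2]].
  + split; [eapply Rle_trans; [apply Rmin_l|lra]|
      eapply Rle_trans; [|apply Rmax_r]; lra].
  + exfalso; apply (Hy z); [|easy].
    unfold Rmin, Rmax in Hz1; destruct (Rle_dec x0 x); lra.
- right; intros x Hx; destruct (Rtotal_order (f x) y) as [H|[H|H]]; [|now apply Hy in H|easy].
  exfalso; apply Hno; now exists x.
Qed.

Lemma rs_normsq_sign k y : exists L, forall c d, 0 <= c -> d <= 2 * PI ->
  (forall z, In z L -> ~ (c < z < d)) ->
  (forall x, c < x < d -> rs_normsq k x < y) \/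
  (forall x, c < x < d -> rs_normsq k x = y) \/
  (forall x, c < x < d -> y < rs_normsq k x).
Proof.
destruct (rs_normsq_level k y) as [H|[L HL]].
- exists nil; intros c d _ _ _; right; left; intros x _; apply H.
- exists L; intros c d Hc Hd HZ.
  destruct (sign_const (rs_normsq k) y c d (cont_rs_normsq k)); [|now left|now right; right].
  intros x Hx Hxy; apply (HZ x); [|easy]; apply HL; [lra|easy].
Qed.

Lemma ex_RInt_ind k alpha beta :
  ex_RInt (fun t => ind_cc alpha beta (rs_normsq k t)) 0 (2 * PI).
Proof.
destruct (rs_normsq_sign k alpha) as [L1 H1], (rs_normsq_sign k beta) as [L2 H2].
apply (ex_RInt_piecewise_const _ (L1 ++ L2)); [left; apply two_PI_pos|].
intros c d Hc Hd HZ.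
specialize (H1 c d Hc Hd (fun z Hz => HZ z (in_or_app _ _ _ (or_introl Hz)))).
specialize (H2 c d Hc Hd (fun z Hz => HZ z (in_or_app _ _ _ (or_intror Hz)))).
(* No level is crossed between c and d, so the midpoint value is the constant. *)
exists (ind_cc alpha beta (rs_normsq k ((c + d) / 2))).
intros x Hx; assert (Hm : c < (c + d) / 2 < d) by lra.
unfold ind_cc.
destruct H1 as [H1|[H1|H1]], H2 as [H2|[H2|H2]];
  pose proof (H1 _ Hx); pose proof (H1 _ Hm); pose proof (H2 _ Hx); pose proof (H2 _ Hm);
  repeat destruct (Rle_dec _ _); lra.
Qed.

(** * Bernstein approximation of indicators and the uniform limit *)

Lemma bern_rec (n : nat) (x : R) (f : nat -> R) :
  sum_f_R0 (fun j => bern (S n) j x * f j) (S n) =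
  (1 - x) * sum_f_R0 (fun j => bern n j x * f j) n +
  x * sum_f_R0 (fun j => bern n j x * f (S j)) n.
Proof.
destruct n as [|n].
{ unfold bern; simpl; rewrite !C_n_0, !C_n_n; simpl; ring. }
rewrite (decomp_sum _ (S (S n))) by lia; cbn [Nat.pred].
rewrite (tech5 _ n).
rewrite (decomp_sum (fun j => bern (S n) j x * f j) (S n)) by lia; cbn [Nat.pred].
rewrite (tech5 (fun j => bern (S n) j x * f (S j)) n).
assert (E : sum_f_R0 (fun i => bern (S (S n)) (S i) x * f (S i)) n =
  (1 - x) * sum_f_R0 (fun i => bern (S n) (S i) x * f (S i)) n +
  x * sum_f_R0 (fun j => bern (S n) j x * f (S j)) n).
{ rewrite !scal_sum, <- sum_plus; apply sum_eq; intros i Hi.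
  unfold bern; rewrite <- (pascal (S n) i) by lia.
  replace (S (S n) - S i)%nat with (S (n - i)) by lia.
  replace (S n - S i)%nat with (n - i)%nat by lia.
  replace (S n - i)%nat with (S (n - i)) by lia.
  simpl pow; ring. }
rewrite E; unfold bern.
rewrite !C_n_0, !C_n_n, !Nat.sub_diag, !Nat.sub_0_r; simpl pow; ring.
Qed.

(** Variance plus squared bias of the binomial law. The centre c is kept general because, in
    [bern_rec], a success replaces c by c - 1. *)
Lemma bern_variance (n : nat) (x c : R) :
  sum_f_R0 (fun j => bern n j x * (INR j - c) ^ 2) n =
  INR n * x * (1 - x) + (INR n * x - c) ^ 2.
Proof.
revert c; induction n as [|n IH]; intros c.
- unfold bern; simpl; rewrite C_n_0; ring.
- rewrite bern_rec, IH.
  rewrite (sum_eq _ (fun j => bern n j x * (INR j - (c - 1)) ^ 2) n).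
  + rewrite IH, S_INR; ring.
  + intros i _; rewrite S_INR; ring.
Qed.

Lemma bern_ge0 n j x : 0 <= x <= 1 -> 0 <= bern n j x.
Proof.
intros Hx; unfold bern, Binomial.C.
repeat apply Rmult_le_pos; try (apply pow_le; lra).
- left; apply lt_0_INR, lt_O_fact.
- left; apply Rinv_0_lt_compat, Rmult_lt_0_compat; apply lt_0_INR, lt_O_fact.
Qed.

Lemma ind_cc_bound a b x : 0 <= ind_cc a b x <= 1.
Proof. unfold ind_cc; repeat destruct (Rle_dec _ _); lra. Qed.

(* Chebyshev's inequality for the binomial law with parameters [n] and [x]. *)
Lemma ind_cc_le_bern (n : nat) (alpha beta delta x : R) :
  (0 < n)%nat -> 0 < delta -> 0 <= x <= 1 ->
  ind_cc alpha beta x <=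
  sum_f_R0 (fun j => bern n j x *
    ind_cc (INR n * (alpha - delta)) (INR n * (beta + delta)) (INR j)) n
  + / (4 * INR n * delta ^ 2).
Proof.
intros Hn Hd Hx.
assert (HN : 0 < INR n) by now apply lt_0_INR.
set (phi := fun j => ind_cc (INR n * (alpha - delta)) (INR n * (beta + delta)) (INR j)).
change (ind_cc alpha beta x <=
  sum_f_R0 (fun j => bern n j x * phi j) n + / (4 * INR n * delta ^ 2)).
assert (Hpos : 0 <= sum_f_R0 (fun j => bern n j x * phi j) n).
{ apply cond_pos_sum; intros j; apply Rmult_le_pos; [now apply bern_ge0|].
  apply ind_cc_bound. }
assert (Hr : 0 < / (4 * INR n * delta ^ 2)).
{ apply Rinv_0_lt_compat; apply Rmult_lt_0_compat; [lra|now apply pow_lt]. }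
destruct (classic (alpha <= x <= beta)) as [Hin|Hout].
2:{ replace (ind_cc alpha beta x) with 0; [lra|].
    unfold ind_cc; repeat destruct (Rle_dec _ _); tauto. }
assert (H1 : 1 <= sum_f_R0 (fun j => bern n j x * phi j) n +
  / (INR n * delta) ^ 2 * sum_f_R0 (fun j => bern n j x * (INR j - INR n * x) ^ 2) n).
{ rewrite <- (bern_sum n x), scal_sum, <- sum_plus; apply sum_Rle; intros j _.
  pose proof (bern_ge0 n j x Hx) as Hb.
  assert (Hnd : 0 < INR n * delta) by now apply Rmult_lt_0_compat.
  (* Either j/n lies in the widened interval, or it is at distance at least [delta] from x. *)
  assert (H : 1 <= phi j + (INR j - INR n * x) ^ 2 * / (INR n * delta) ^ 2).
  { assert (Hq : 0 <= (INR j - INR n * x) ^ 2 * / (INR n * delta) ^ 2).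
    { apply Rmult_le_pos; [apply pow2_ge_0|left; apply Rinv_0_lt_compat; now apply pow_lt]. }
    assert (Hfar : INR n * delta <= Rabs (INR j - INR n * x) ->
      1 <= (INR j - INR n * x) ^ 2 * / (INR n * delta) ^ 2).
    { intros Hfar; apply (Rmult_le_reg_r ((INR n * delta) ^ 2)); [now apply pow_lt|].
      rewrite Rmult_assoc, Rinv_l, Rmult_1_l, Rmult_1_r
        by (apply pow_nonzero; lra).
      rewrite <- (pow2_abs (INR j - INR n * x)); apply pow_incr; lra. }
    unfold phi, ind_cc in *.
    destruct (Rle_dec _ _) as [Ha|Ha];
      [destruct (Rle_dec _ _) as [Hb'|Hb']; [lra|]|].
    - rewrite Rplus_0_l; apply Hfar; rewrite Rabs_pos_eq; nra.
    - rewrite Rplus_0_l; apply Hfar; rewrite Rabs_left1; nra. }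
  nra. }
rewrite bern_variance in H1.
replace (INR n * x * (1 - x) + (INR n * x - INR n * x) ^ 2)
  with (INR n * (x * (1 - x))) in H1 by ring.
(* The constant 4 comes from x (1 - x) <= 1/4. *)
assert (H2 : / (INR n * delta) ^ 2 * (INR n * (x * (1 - x))) <= / (4 * INR n * delta ^ 2)).
{ replace (/ (INR n * delta) ^ 2 * (INR n * (x * (1 - x))))
    with (/ (4 * INR n * delta ^ 2) * (4 * (x * (1 - x)))) by (field; lra).
  rewrite <- (Rmult_1_r (/ (4 * INR n * delta ^ 2))) at 2.
  apply Rmult_le_compat_l; [lra|pose proof (pow2_ge_0 (2 * x - 1)); nra]. }
pose proof (ind_cc_bound alpha beta x); lra.
Qed.

Lemma ind_cc_count (n : nat) (a b : R) : a <= b ->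
  sum_f_R0 (fun j => ind_cc a b (INR j)) n <= b - a + 1.
Proof.
intros Hab.
(* The induction needs a bound that sees only the integers up to n. *)
assert (H : sum_f_R0 (fun j => ind_cc a b (INR j)) n <= Rmax 0 (Rmin b (INR n) - a + 1)).
{ induction n as [|n IH].
  - simpl; unfold ind_cc, Rmax, Rmin; repeat destruct (Rle_dec _ _); lra.
  - rewrite tech5; revert IH; generalize (sum_f_R0 (fun j => ind_cc a b (INR j)) n).
    intros s; rewrite S_INR; unfold ind_cc, Rmax, Rmin.
    repeat destruct (Rle_dec _ _); lra. }
eapply Rle_trans; [exact H|].
unfold Rmax, Rmin; repeat destruct (Rle_dec _ _); lra.
Qed.

Lemma mean_ind_upper (alpha beta eps : R) : alpha <= beta -> 0 < eps ->
  exists K, forall k, (K <= k)%nat ->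
    mean (fun t => ind_cc alpha beta (rs_normsq k t)) <= beta - alpha + eps.
Proof.
(* Error budget: widening costs 2 [delta] = eps/4, the choice of n bounds the counting and Chebyshev
   errors by eps/4 together, and for this fixed n convergence in k costs eps/4. *)
intros Hab He; set (delta := eps / 8).
assert (Hd : 0 < delta) by (unfold delta; lra).
set (M := 1 + / (4 * delta ^ 2)).
assert (HM : 0 < M).
{ unfold M; assert (0 < / (4 * delta ^ 2)); [|lra].
  apply Rinv_0_lt_compat, Rmult_lt_0_compat; [lra|now apply pow_lt]. }
destruct (INR_unbounded (Rmax 1 (4 * M / eps))) as [n Hn].
assert (Hn1 : 1 < INR n) by (eapply Rle_lt_trans; [apply Rmax_l|exact Hn]).
assert (Hn2 : 4 * M / eps < INR n) by (eapply Rle_lt_trans; [apply Rmax_r|exact Hn]).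
assert (Hn0 : (0 < n)%nat) by (apply INR_lt; simpl; lra).
assert (Hsmall : / INR n + / (4 * INR n * delta ^ 2) <= eps / 4).
{ replace (/ INR n + / (4 * INR n * delta ^ 2)) with (M / INR n)
    by (unfold M; field; split; lra).
  apply (Rmult_le_reg_r (INR n)); [lra|].
  replace (M / INR n * INR n) with (eps / 4 * (4 * M / eps)) by (field; lra).
  apply Rmult_le_compat_l; lra. }
set (phi := fun j => ind_cc (INR n * (alpha - delta)) (INR n * (beta + delta)) (INR j)).
set (S := fun k => sum_f_R0 (fun j => mean (fun t => bern n j (rs_normsq k t)) * phi j) n).
assert (HS : is_lim_seq (fun k => S k - sum_f_R0 (fun j => / (INR n + 1) * phi j) n) 0).
{ apply (is_lim_seq_ext (fun k => sum_f_R0 (fun j => phi j *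
    (mean (fun t => bern n j (rs_normsq k t)) - 1 / (INR n + 1))) n)).
  - intros k; unfold S; rewrite <- minus_sum; apply sum_eq; intros j _; field; lra.
  - apply is_lim_seq_sum0; intros j Hj; apply is_lim_seq_0_scal.
    replace 0 with (1 / (INR n + 1) - 1 / (INR n + 1)) by ring.
    apply is_lim_seq_minus'; [now apply bern_limit|apply is_lim_seq_const]. }
apply is_lim_seq_spec in HS.
assert (He4 : 0 < eps / 4) by lra.
destruct (HS (mkposreal _ He4)) as [K HK]; simpl in HK.
exists K; intros k Hk; specialize (HK k Hk).
rewrite Rminus_0_r in HK; apply Rabs_def2 in HK.
assert (Hcount : sum_f_R0 (fun j => / (INR n + 1) * phi j) n <=
  beta - alpha + 2 * delta + / INR n).
{ rewrite (sum_eq _ (fun j => phi j * / (INR n + 1))) by (intros; ring).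
  rewrite <- scal_sum.
  assert (Hc : sum_f_R0 phi n <= INR n * (beta - alpha + 2 * delta) + 1).
  { replace (INR n * (beta - alpha + 2 * delta) + 1)
      with (INR n * (beta + delta) - INR n * (alpha - delta) + 1) by ring.
    apply ind_cc_count, Rmult_le_compat_l; lra. }
  apply (Rmult_le_reg_l (INR n + 1)); [lra|].
  rewrite <- Rmult_assoc, Rinv_r, Rmult_1_l by lra.
  assert (0 < / INR n) by (apply Rinv_0_lt_compat; lra).
  replace ((INR n + 1) * (beta - alpha + 2 * delta + / INR n)) with
    (INR n * (beta - alpha + 2 * delta) + 1 + (beta - alpha + 2 * delta) + / INR n)
    by (field; lra).
  lra. }
assert (Hmean : mean (fun t => ind_cc alpha beta (rs_normsq k t)) <=
  S k + / (4 * INR n * delta ^ 2)).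
{ assert (Hcont : forall j, cont (fun t => bern n j (rs_normsq k t) * phi j)).
  { intros j; apply cont_mult; [apply cont_bern|apply cont_const]. }
  assert (E : S k = mean (fun t => sum_f_R0 (fun j => bern n j (rs_normsq k t) * phi j) n)).
  { rewrite (mean_sum (fun j t => bern n j (rs_normsq k t) * phi j)) by easy.
    unfold S; apply sum_eq; intros j _; rewrite Rmult_comm, <- mean_scal.
    - apply mean_ext; intros t; ring.
    - apply cont_ex_RInt, cont_bern. }
  rewrite E, <- (mean_const (/ (4 * INR n * delta ^ 2))), <- mean_plus.
  - apply mean_le; [apply ex_RInt_ind| |].
    + apply cont_ex_RInt, cont_plus; [|apply cont_const].
      now apply (cont_sum (fun j t => bern n j (rs_normsq k t) * phi j)).
    + intros t; apply ind_cc_le_bern; [easy|easy|apply rs_normsq_bound].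
  - apply cont_ex_RInt.
    now apply (cont_sum (fun j t => bern n j (rs_normsq k t) * phi j)).
  - apply ex_RInt_const. }
unfold delta in *; lra.
Qed.

(* The lower bound is the upper bound for the two complementary intervals. *)
Lemma mean_ind_limit (alpha beta : R) : 0 <= alpha -> alpha < beta -> beta <= 1 ->
  is_lim_seq (fun k => mean (fun t => ind_cc alpha beta (rs_normsq k t))) (beta - alpha).
Proof.
intros Ha Hab Hb; apply is_lim_seq_spec; intros eps.
pose proof (cond_pos eps) as He.
assert (He3 : 0 < eps / 3) by lra.
destruct (mean_ind_upper alpha beta (eps / 3)) as [K1 H1]; [lra|lra|].
destruct (mean_ind_upper 0 alpha (eps / 3)) as [K2 H2]; [lra|lra|].
destruct (mean_ind_upper beta 1 (eps / 3)) as [K3 H3]; [lra|lra|].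
exists (K1 + K2 + K3)%nat; intros k Hk.
specialize (H1 k ltac:(lia)); specialize (H2 k ltac:(lia)); specialize (H3 k ltac:(lia)).
(* The three closed intervals cover [0, 1]; overlaps at the endpoints only increase the sum. *)
assert (H : 1 <= mean (fun t => ind_cc 0 alpha (rs_normsq k t))
  + mean (fun t => ind_cc alpha beta (rs_normsq k t))
  + mean (fun t => ind_cc beta 1 (rs_normsq k t))).
{ assert (Hex : ex_RInt (fun t => ind_cc 0 alpha (rs_normsq k t)
    + ind_cc alpha beta (rs_normsq k t)) 0 (2 * PI))
    by (apply (ex_RInt_plus (V := R_NormedModule)); apply ex_RInt_ind).
  rewrite <- (mean_plus _ _ (ex_RInt_ind k 0 alpha) (ex_RInt_ind k alpha beta)).
  rewrite <- (mean_plus _ _ Hex (ex_RInt_ind k beta 1)).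
  rewrite <- (mean_const 1) at 1; apply mean_le.
  - apply ex_RInt_const.
  - apply (ex_RInt_plus (V := R_NormedModule)); [exact Hex|apply ex_RInt_ind].
  - intros t; pose proof (rs_normsq_bound k t).
    unfold ind_cc; repeat destruct (Rle_dec _ _); lra. }
apply Rabs_def1; lra.
Qed.

(* omega = e^{i t} with t uniform on [0, 2*PI]; E g(omega) = (1/(2 PI)) int_0^{2 PI} g(e^{it}) dt. *)
Theorem mainTheorem1 :
  (forall n : nat,
     exists pr : forall k : nat,
         Riemann_integrable (fun t => (rs_normsq k t) ^ n) 0 (2 * PI),
       Un_cv (fun k => RiemannInt (pr k) / (2 * PI)) (1 / (INR n + 1)))
  /\
  (forall alpha beta : R, 0 <= alpha -> alpha < beta -> beta <= 1 ->
     exists pr : forall k : nat,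
         Riemann_integrable (fun t => ind_cc alpha beta (rs_normsq k t)) 0 (2 * PI),
       Un_cv (fun k => RiemannInt (pr k) / (2 * PI)) (beta - alpha)).
Proof.
split.
- intros n.
  exists (fun k => ex_RInt_Reals_0 _ _ _ (cont_ex_RInt _ 0 (2 * PI)
    (cont_pow _ n (cont_rs_normsq k)))).
  apply is_lim_seq_Reals.
  (* The top Bernstein polynomial is x^n itself. *)
  apply (is_lim_seq_ext (fun k => mean (fun t => bern n n (rs_normsq k t)))).
  + intros k; rewrite <- RInt_Reals; apply mean_ext; intros t; unfold bern.
    rewrite C_n_n, Nat.sub_diag; simpl; ring.
  + now apply bern_limit.
- intros alpha beta Ha Hab Hb.
  exists (fun k => ex_RInt_Reals_0 _ _ _ (ex_RInt_ind k alpha beta)).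
  apply is_lim_seq_Reals.
  apply (is_lim_seq_ext (fun k => mean (fun t => ind_cc alpha beta (rs_normsq k t)))).
  + intros k; now rewrite <- RInt_Reals.
  + now apply mean_ind_limit.
Qed.
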